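(* Let $\alpha,\beta,\gamma>-1$. For $n=0,1,2$, a basis $\{Y_{n,i}\}$ of $\mathcal{BV}_n^2$ is given by $$Y_{0,1}(x,y)=1,\quad Y_{1,1}(x,y)=x,\quad Y_{1,2}(x,y)=y,$$ $$Y_{2,1}(x,y)=p_{1,1}^{\alpha,\beta,\gamma}(x^2,y^2),\quad Y_{2,2}(x,y)=xy,\quad Y_{2,3}(x,y)=p_{1,2}^{\alpha,\beta,\gamma}(x^2,y^2).$$ For $n\ge3$, four polynomials in $\mathcal{BV}_n^2$ that are linearly independent modulo the ideal $I=\langle(1-x^2)(1-y^2)\rangle$ are given by $$\begin{aligned}Y_{2m,1}(x,y)&=p_{m,1}^{\alpha,\beta,\gamma}(x^2,y^2),& Y_{2m,2}(x,y)&=p_{m,2}^{\alpha,\beta,\gamma}(x^2,y^2),\\ Y_{2m,3}(x,y)&=xy\,p_{m-1,1}^{\alpha+1,\beta+1,\gamma}(x^2,y^2),& Y_{2m,4}(x,y)&=xy\,p_{m-1,2}^{\alpha+1,\beta+1,\gamma}(x^2,y^2)\end{aligned}$$ for $n=2m\ge4$, and $$\begin{aligned}Y_{2m+1,1}(x,y)&=x\,p_{m,1}^{\alpha+1,\beta,\gamma}(x^2,y^2),& Y_{2m+1,2}(x,y)&=x\,p_{m,2}^{\alpha+1,\beta,\gamma}(x^2,y^2),\\ Y_{2m+1,3}(x,y)&=y\,p_{m,1}^{\alpha,\beta+1,\gamma}(x^2,y^2),& Y_{2m+1,4}(x,y)&=y\,p_{m,2}^{\alpha,\beta+1,\gamma}(x^2,y^2)\end{aligned}$$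 for $n=2m+1\ge3$. In particular, these bases satisfy the equation $\partial_x^2\partial_y^2u=0$.
   Context: For $\alpha,\gamma>-1$ let $w_{\alpha,\gamma}(x)=x^\alpha(1-x)^\gamma$ on $[0,1]$, $c_{\alpha,\gamma}=\left(\int_0^1w_{\alpha,\gamma}\right)^{-1}$, $\varpi_{\alpha,\gamma}(x)=|x|^{2\alpha+1}(1-x^2)^\gamma$ on $[-1,1]$. Boundary of the square: $$\langle f,g\rangle=c_{\alpha,\gamma}\int_{-1}^1[f(x,-1)g(x,-1)+f(x,1)g(x,1)]\varpi_{\alpha,\gamma}(x)\,dx+c_{\beta,\gamma}\int_{-1}^1[f(-1,y)g(-1,y)+f(1,y)g(1,y)]\varpi_{\beta,\gamma}(y)\,dy,$$ an inner product on $\mathbb R[x,y]/I$, $I=\langle(1-x^2)(1-y^2)\rangle$. $\mathcal{BV}_n^2$ is the space of classes modulo $I$ of polynomials of total degree at most $n$ orthogonal, with respect to $\langle\cdot,\cdot\rangle$, to all polynomials of total degree at most $n-1$. Wedge: for $a,b,\gamma>-1$ and $\sigma>0$, $$\langle f,g\rangle_{a,b,\gamma}=c_{a,\gamma}\int_0^1f(x,1)g(x,1)w_{a,\gamma}(x)\,dx+\sigma c_{b,\gamma}\int_0^1f(1,y)g(1,y)w_{b,\gamma}(y)\,dy,$$ an inner product on $\mathbb R[x,y]/\langle(1-x)(1-y)\rangle$; $\mathcal H_m^2(w_{a,\gamma},w_{b,\gamma})$ is the (two-dimensional for $m\ge1$) space of classes of polynomials of total degree at most $m$ orthogonal with respect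 to $\langle\cdot,\cdot\rangle_{a,b,\gamma}$ to all polynomials of total degree at most $m-1$. For $\delta_1,\delta_2\in\{0,1\}$ and $m\ge1$, $\{p_{m,1}^{\alpha+\delta_1,\beta+\delta_2,\gamma},\,p_{m,2}^{\alpha+\delta_1,\beta+\delta_2,\gamma}\}$ denotes a basis of $\mathcal H_m^2(w_{\alpha+\delta_1,\gamma},w_{\beta+\delta_2,\gamma})$ for the choice $$\sigma=\sigma_{\delta_1,\delta_2}=\frac{c_{\beta,\gamma}\,c_{\alpha+\delta_1,\gamma}}{c_{\alpha,\gamma}\,c_{\beta+\delta_2,\gamma}},$$ consisting of polynomials $p$ of degree $m$ with $\partial_x\partial_yp=0$ (i.e. of the form $u(x)+v(y)$, $\deg u,\deg v\le m$). *)

(* Defs.v *)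
From HB Require Import structures.
From mathcomp Require Import all_boot all_order all_algebra.
(* The notations of multinomials are incompatible with those of
   MathComp-Analysis, so only its constants and instances are imported. *)
From mathcomp Require Export -(notations) mpoly.
From mathcomp Require Import all_classical all_reals all_analysis.

Set Implicit Arguments.
Unset Strict Implicit.
Unset Printing Implicit Defensive.

Import Order.TTheory GRing.Theory Num.Theory.

Local Open Scope classical_set_scope.
Local Open Scope ring_scope.

Notation bipoly R := (mpoly 2 R).

Section BivariatePolynomials.
Context {R : realType}.
Implicit Types (p q f g : bipoly R) (J V : set (bipoly R)).

Definition polX : bipoly R := mpolyX R (mnm1 (ord0 : 'I_2)).
Definition polY : bipoly R := mpolyX R (mnm1 (ord_max : 'I_2)).

Definition eval2 f (x y : R) : R := meval (tnth [tuple x; y]) f.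

Definition dx f : bipoly R := mderiv (ord0 : 'I_2) f.
Definition dy f : bipoly R := mderiv (ord_max : 'I_2) f.

(* p(x^2, y^2) *)
Definition sqvars p : bipoly R := comp_mpoly [tuple polX ^+ 2; polY ^+ 2] p.

Definition principal_ideal q : set (bipoly R) := [set f | exists h, f = h * q].

(* Elements of the quotient by an ideal J are handled through representatives.
   Since msize f is 1 + the total degree of f (and msize 0 = 0), the bound
   (msize f <= n.+1)%N says that f has total degree at most n, and
   (msize q <= n)%N that q has total degree at most n - 1, which for n = 0
   leaves only q = 0. *)
Definition orth_space J (ip : bipoly R -> bipoly R -> R) (n : nat) :
    set (bipoly R) :=
  [set f | exists g, [/\ J (f - g), (msize g <= n.+1)%N &
             forall q, (msize q <= n)%N -> ip g q = 0]].

Definition free_mod J (s : seq (bipoly R)) : Prop :=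
  forall c : 'I_(size s) -> R,
    J (\sum_(i < size s) c i *: s`_i) -> forall i, c i = 0.

Definition basis_mod J V (s : seq (bipoly R)) : Prop :=
  [/\ {in s, forall f, V f},
      free_mod J s &
      forall f, V f -> exists c : 'I_(size s) -> R,
        J (f - \sum_(i < size s) c i *: s`_i)].

End BivariatePolynomials.

Section InnerProducts.
Context {R : realType}.
Implicit Types (a b gam sigma x y : R) (f g : bipoly R).

Local Notation mu := (@lebesgue_measure R).

Definition jacobi_weight a gam x : R := x `^ a * (1 - x) `^ gam.

Definition jacobi_const a gam : R :=
  (\int[mu]_(x in `[0, 1]) jacobi_weight a gam x)^-1.

Definition sym_weight a gam x : R :=
  `|x| `^ (2 * a + 1) * (1 - x ^+ 2) `^ gam.

Definition square_ip a b gam f g : R :=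
  jacobi_const a gam *
    (\int[mu]_(x in `[-1, 1])
       ((eval2 f x (-1) * eval2 g x (-1) + eval2 f x 1 * eval2 g x 1)
        * sym_weight a gam x)) +
  jacobi_const b gam *
    (\int[mu]_(y in `[-1, 1])
       ((eval2 f (-1) y * eval2 g (-1) y + eval2 f 1 y * eval2 g 1 y)
        * sym_weight b gam y)).

Definition wedge_ip sigma a b gam f g : R :=
  jacobi_const a gam *
    (\int[mu]_(x in `[0, 1])
       (eval2 f x 1 * eval2 g x 1 * jacobi_weight a gam x)) +
  sigma * jacobi_const b gam *
    (\int[mu]_(y in `[0, 1])
       (eval2 f 1 y * eval2 g 1 y * jacobi_weight b gam y)).

End InnerProducts.

Section Spaces.
Context {R : realType}.
Implicit Types (a b gam sigma : R) (p : bipoly R).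

Definition square_ideal : set (bipoly R) :=
  principal_ideal ((1 - polX ^+ 2) * (1 - polY ^+ 2)).

Definition BV a b gam (n : nat) : set (bipoly R) :=
  orth_space square_ideal (square_ip a b gam) n.

Definition wedge_ideal : set (bipoly R) :=
  principal_ideal ((1 - polX) * (1 - polY)).

Definition wedge_space sigma a b gam (m : nat) : set (bipoly R) :=
  orth_space wedge_ideal (wedge_ip sigma a b gam) m.

(* The shifts delta_1, delta_2 in {0, 1} are booleans. *)
Definition shift a (d : bool) : R := a + (nat_of_bool d)%:R.

Definition wedge_sigma a b gam (d1 d2 : bool) : R :=
  (jacobi_const b gam * jacobi_const (shift a d1) gam) /
  (jacobi_const a gam * jacobi_const (shift b d2) gam).

Definition wedge_basis a b gam (d1 d2 : bool) (m : nat)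
    (s : seq (bipoly R)) : Prop :=
  basis_mod wedge_ideal
    (wedge_space (wedge_sigma a b gam d1 d2) (shift a d1) (shift b d2) gam m)
    s
  /\ {in s, forall p, msize p = m.+1 /\ dx (dy p) = 0}.

End Spaces.

(* Main.v *)
Require Import Defs.
From mathcomp Require Import all_boot all_order all_algebra.
From mathcomp Require Import all_classical all_reals all_analysis.
From mathcomp Require Import measurable_realfun zify ring lra.

Set Implicit Arguments.
Unset Strict Implicit.
Unset Printing Implicit Defensive.

Import Order.TTheory GRing.Theory Num.Theory.
Import numFieldNormedType.Exports.

Local Open Scope classical_set_scope.
Local Open Scope ring_scope.

(** The weights on the boundary of the square are even, so the inner product
    is invariant under x -> -x and under y -> -y.  Every polynomial is a sum
    of four pieces x^d1 y^d2 g(x^2, y^2) with d1, d2 in {0, 1}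
    ([parity_decomposition]), and pieces with different (d1, d2) are
    orthogonal ([square_ip_sqlift_neq]).

    On a single parity class the problem becomes one on the wedge.  The
    substitution t = x^2 carries |x|^(2a+1) (1 - x^2)^gam dx on [-1, 1] to
    t^a (1 - t)^gam dt on [0, 1] ([integral_sym_weight]), and the factor
    x^(2 d1) produced by the product of two pieces raises a to a + d1.  Hence
    the inner product of x^d1 y^d2 f(x^2, y^2) and x^d1 y^d2 g(x^2, y^2) on
    the square is a positive multiple of the wedge inner product of f and g
    with parameters a + d1 and b + d2 ([square_ip_sqlift]): the constant sigma
    is the ratio between the two edges for which this holds.

    A piece x^d1 y^d2 g(x^2, y^2) has degree at most n exactly when
    2 deg g + d1 + d2 <= n.  So a class lies in BV_n if and only if each of
    its components g has degree at most (n - d1 - d2) / 2 and is orthogonal to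
    all polynomials of degree at most (n - 1 - d1 - d2) / 2, both rounded down
    ([BV_sqlift], [BV_graded_parts]).  If n - d1 - d2 = 2m this says that g
    lies in the wedge space of degree m (the constants when m = 0).  If
    n - d1 - d2 is odd the two bounds agree, so g is orthogonal to itself and
    vanishes modulo the wedge ideal, because the wedge inner product is
    positive definite there ([wedge_ip_eq0]).  Two of the four classes survive
    for each n, and the lifts of their wedge bases together form a basis of
    BV_n ([basis_mod_blocks]).  Independence rests on the same orthogonality:
    a combination in the ideal of the square has all its components in the
    wedge ideal ([sqlift_sum_in_ideal]).

    The differential equation comes from the chain rule: if the mixed
    derivative of p vanishes then so does that of p(x^2, y^2), and multiplying
    by x, y or xy costs one further application of the mixed derivative
    ([dxxyy_sqlift]).

    Since the exponents may be negative, the weights can be unbounded at the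
    end points.  Integrability and the change of variables are therefore
    proved on compact subintervals of ]0, 1[ and carried to the limit by
    monotone convergence ([ge0_cvg_integral_oo]). *)

(** * Integration over the open unit interval by exhaustion *)

Section Exhaustion.
Context {R : realType}.
Local Notation mu := (@lebesgue_measure R).
Implicit Types (a b gam x y : R) (f F : R -> R) (u v : R^nat).

Lemma ge0_cvg_integral_oo (f : R -> \bar R) a b u v :
  nonincreasing_seq u -> nondecreasing_seq v ->
  u @ \oo --> a -> v @ \oo --> b ->
  (forall n, a < u n) -> (forall n, v n < b) ->
  measurable_fun `]a, b[ f ->
  {in `]a, b[, forall x, 0 <= f x}%E ->
  (\int[mu]_(x in `[u n, v n]) f x @[n --> \oo] -->
   \int[mu]_(x in `]a, b[) f x)%E.
Proof.
move=> niu ndv ua vb au bv mf f0.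
have sub n : `[u n, v n] `<=` `]a, b[.
  move=> x /=; rewrite !in_itv/= => /andP[ux xv].
  by rewrite (lt_le_trans (au n))// (le_lt_trans xv).
have -> : `]a, b[%classic = \bigcup_n `[u n, v n]%classic.
  apply/seteqP; split=> [x|x [n _ /sub//]].
  rewrite /= in_itv/= => /andP[ax xb].
  have : \forall n \near \oo, u n <= x <= v n.
    near=> n; apply/andP; split.
      by near: n; move/cvgr_le : ua; exact.
    by near: n; move/cvgr_ge : vb; exact.
  by case=> n _ /(_ n (leqnn n)) h; exists n => //=; rewrite in_itv.
apply: (@ge0_nondecreasing_set_cvg_integral _ (measurableTypeR R) _
  (fun n => `[u n, v n]%classic)) => //.
- move=> m n mn; apply/subsetPset/subset_itv; rewrite bnd_simp.
    exact: niu.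
  exact: ndv.
- by move=> n; apply: measurable_funS mf => //; exact: sub.
- by move=> n x /sub; exact: f0.
Unshelve. all: by end_near. Qed.

(** The shift by 3 makes every term smaller than 1/2, so that
    [inner_seq n, 1 - inner_seq n] is never degenerate. *)
Definition inner_seq : R^nat := fun n => n.+3%:R^-1.

Lemma inner_seq_gt0 n : 0 < inner_seq n.
Proof. by rewrite invr_gt0. Qed.

Lemma inner_seq_lt n : inner_seq n < 2^-1.
Proof. by rewrite ltf_pV2 ?posrE// ltr_nat. Qed.

Lemma nonincreasing_inner_seq : nonincreasing_seq inner_seq.
Proof. by move=> m n mn; rewrite lef_pV2 ?posrE// ler_nat. Qed.

Lemma cvg_inner_seq : inner_seq @ \oo --> 0.
Proof.
have := @cvg_harmonic R; rewrite -(cvg_shiftn 2) => h.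
apply: cvg_trans h; apply: near_eq_cvg; near=> n.
by rewrite /inner_seq /harmonic/= addn2.
Unshelve. all: by end_near. Qed.

Lemma continuous_is_derive_itv (f F : R -> R) a b :
  (forall x, x \in `[a, b] -> is_derive x 1 F (f x)) ->
  a < b -> derivable_oo_LRcontinuous F a b.
Proof.
move=> dF ab.
have cF x : x \in `[a, b] -> {for x, continuous F}.
  move=> /dF [+ _] => /derivable1_diffP/differentiable_continuous; exact.
split.
- by move=> x /subset_itv_oo_cc /dF [].
- by apply: cvg_at_right_filter; apply: cF; rewrite in_itv/= lexx ltW.
- by apply: cvg_at_left_filter; apply: cF; rewrite in_itv/= lexx ltW.
Qed.

(** On each compact subinterval the integral is a difference of two values of
    the primitive, hence at most 2 M, and this bound passes to the limit. *)
Lemma ge0_bounded_primitive_integrable f F (M : R) :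
  {in `]0, 1[, forall x, 0 <= f x} ->
  {in `]0, 1[, continuous f} ->
  {in `]0, 1[, forall x, is_derive x 1 F (f x)} ->
  {in `]0, 1[, forall x, `|F x| <= M} ->
  mu.-integrable `]0, 1[ (EFin \o f).
Proof.
move=> f0 cf dF FM.
have mf : measurable_fun (`]0, 1[ : set R) f.
  by apply: open_continuous_measurable_fun => // x /set_mem; exact: cf.
apply/integrableP; split; first exact/measurable_EFinP.
have <- : (\int[mu]_(x in `]0%R, 1%R[) (f x)%:E =
           \int[mu]_(x in `]0%R, 1%R[) `|(EFin \o f) x|)%E.
  by apply: eq_integral => x /set_mem /f0 fx0; rewrite gee0_abs// lee_fin.
apply: (@le_lt_trans _ _ (2 * M)%:E); last by rewrite ltry.
have sub n : {subset `[inner_seq n, 1 - inner_seq n] <= `]0, 1[}.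
  move=> x; rewrite !in_itv/=.
  by have := inner_seq_gt0 n; lra.
have cvg1 : (fun n => 1 - inner_seq n) @ \oo --> (1 : R).
  rewrite -[X in _ --> X]subr0.
  by apply: cvgB; [exact: cvg_cst|exact: cvg_inner_seq].
have nd1 : nondecreasing_seq (fun n => 1 - inner_seq n).
  by move=> m n mn; rewrite lerB//; exact: nonincreasing_inner_seq.
have lt1 n : 1 - inner_seq n < 1 by rewrite ltrBlDr ltrDl inner_seq_gt0.
have cvgI := @ge0_cvg_integral_oo (EFin \o f) 0 1 _ _
  nonincreasing_inner_seq nd1 cvg_inner_seq cvg1 inner_seq_gt0 lt1
  ((measurable_EFinP _ _).2 mf) f0.
rewrite -(cvg_lim _ cvgI)//; apply: lime_le.
  by apply/cvg_ex; eexists; exact: cvgI.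
apply: nearW => n.
have ulv : inner_seq n < 1 - inner_seq n by have := inner_seq_lt n; lra.
rewrite (@continuous_FTC2 _ f F)//.
- rewrite -EFinB lee_fin.
  have /FM : 1 - inner_seq n \in `]0, 1[.
    by apply: sub; rewrite in_itv/=; lra.
  have /FM : inner_seq n \in `]0, 1[.
    by apply: sub; rewrite in_itv/=; lra.
  by rewrite !ler_norml; lra.
- by apply: continuous_in_subspaceT => x /set_mem/= /sub; exact: cf.
- by apply: (@continuous_is_derive_itv f) => // x /sub; exact: dF.
- move=> x xuv; rewrite derive1E.
  have x01 : x \in `]0, 1[.
    apply: (sub n). exact: subset_itv_oo_cc.
  by have [_ ->] := dF _ x01.
Qed.

End Exhaustion.

(** * Integrability of the Jacobi weight *)

Section JacobiWeight.
Context {R : realType}.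
Local Notation mu := (@lebesgue_measure R).
Implicit Types (a b e gam x y : R).

Lemma powR_le1 e x : 0 <= e -> 0 <= x -> x <= 1 -> x `^ e <= 1.
Proof.
move=> e0 x0 x1; have := @ge0_ler_powR R e e0 x 1.
by rewrite powR1 !nnegrE; apply.
Qed.

(** The two terms on the right bound the power for nonnegative and for
    negative exponents respectively. *)
Lemma powR_upper_half_le gam y :
  2^-1 <= y -> y <= 1 -> y `^ gam <= 1 + 2^-1 `^ gam.
Proof.
move=> y2 y1; have y0 : 0 < y by lra.
have [g0|g0] := leP 0 gam.
  apply: (@le_trans _ _ 1); last by rewrite lerDl powR_ge0.
  by apply: powR_le1; rewrite // ltW.
apply: (@le_trans _ _ (2^-1 `^ gam)); last by rewrite lerDr ler01.
rewrite -[gam]opprK powRN [leRHS]powRN lef_pV2 ?posrE ?powR_gt0//.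
by apply: ge0_ler_powR; rewrite // ?nnegrE; lra.
Qed.

Lemma is_derive_powR_primitive a x : -1 < a -> 0 < x ->
  is_derive x 1 (fun t => (a + 1)^-1 * t `^ (a + 1)) (x `^ a).
Proof.
move=> a1 x0; have -> : x `^ a = (a + 1)^-1 *: ((a + 1) * x `^ (a + 1 - 1)).
  by rewrite /GRing.scale/= addrK mulKf//; lra.
by apply: is_deriveZ; exact: is_derive1_powR.
Qed.

Lemma continuous_powR a x : 0 < x -> {for x, continuous (fun t : R => t `^ a)}.
Proof.
move=> x0; apply: differentiable_continuous; apply/derivable1_diffP.
by have [] := is_derive1_powR a x0.
Qed.

Lemma bounded_powR_primitive a x : -1 < a -> 0 <= x -> x <= 1 ->
  `|(a + 1)^-1 * x `^ (a + 1)| <= (a + 1)^-1.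
Proof.
move=> a1 x0 x1; have a0 : 0 < a + 1 by lra.
rewrite ger0_norm; last by rewrite mulr_ge0 ?powR_ge0// invr_ge0 ltW.
by rewrite ler_piMr ?invr_ge0 ?powR_le1 ?(ltW a0).
Qed.

Lemma integrable_powR a : -1 < a ->
  mu.-integrable `]0, 1[ (EFin \o (fun t : R => t `^ a)).
Proof.
move=> a1.
apply: (@ge0_bounded_primitive_integrable _ _
  (fun t => (a + 1)^-1 * t `^ (a + 1)) (a + 1)^-1).
- by move=> x _; exact: powR_ge0.
- by move=> x; rewrite in_itv/= => /andP[x0 _]; exact: continuous_powR.
- move=> x; rewrite in_itv/= => /andP[x0 _].
  exact: is_derive_powR_primitive.
- move=> x; rewrite in_itv/= => /andP[x0 x1].
  by apply: bounded_powR_primitive; rewrite // ltW.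
Qed.

Lemma continuous_onem_powR a x : x < 1 ->
  {for x, continuous (fun t : R => (1 - t) `^ a)}.
Proof.
move=> x1.
apply: (@continuous_comp _ _ _ (fun t : R => 1 - t) (fun t : R => t `^ a)).
  by apply: cvgB; [exact: cvg_cst|exact: cvg_id].
by apply: continuous_powR; rewrite subr_gt0.
Qed.

Lemma integrable_onem_powR a : -1 < a ->
  mu.-integrable `]0, 1[ (EFin \o (fun x => (1 - x) `^ a)).
Proof.
move=> a1.
apply: (@ge0_bounded_primitive_integrable _ _
  (fun t => - ((a + 1)^-1 * (1 - t) `^ (a + 1))) (a + 1)^-1).
- by move=> x _; exact: powR_ge0.
- by move=> x; rewrite in_itv/= => /andP[_ x1]; exact: continuous_onem_powR.
- move=> x; rewrite in_itv/= => /andP[_ x1].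
  rewrite -[X in is_derive _ _ _ X]opprK; apply: is_deriveN.
  have d1 : is_derive x 1 (fun t : R => 1 - t) (-1).
    by rewrite -[X in is_derive _ _ _ X]add0r; apply: is_deriveB.
  have x0 : 0 < 1 - x by lra.
  have := @is_derive1_comp _ _ (fun t : R => 1 - t) _ _ _
    (is_derive_powR_primitive a1 x0) d1.
  by rewrite mulrN1.
- move=> x; rewrite in_itv/= => /andP[x0 x1]; rewrite normrN.
  by apply: bounded_powR_primitive; lra.
Qed.

Lemma measurable_jacobi_weight a gam :
  measurable_fun [set: R] (jacobi_weight a gam).
Proof.
apply: measurable_funM; first exact: measurable_powR.
apply: (@measurableT_comp _ _ _ _ _ _ (fun t : R => t `^ gam)).
  exact: measurable_powR.
exact: measurable_funB.
Qed.

Lemma measurable_jacobi_weight_EFin a gam (D : set R) :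
  measurable_fun D (EFin \o jacobi_weight a gam).
Proof.
apply/measurable_EFinP; apply: measurable_funTS.
exact: measurable_jacobi_weight.
Qed.

Lemma jacobi_weight_ge0 a gam x : 0 <= jacobi_weight a gam x.
Proof. by rewrite mulr_ge0 ?powR_ge0. Qed.

(** On the left half of the interval the factor (1 - x)^gam is bounded, on the
    right half the factor x^a is, so the weight is dominated by a combination
    of two pure powers. *)
Lemma integrable_jacobi_weight_oo a gam : -1 < a -> -1 < gam ->
  mu.-integrable `]0, 1[ (EFin \o jacobi_weight a gam).
Proof.
move=> a1 g1.
pose C (e : R) := 1 + 2^-1 `^ e.
have C0 e : 0 <= C e by rewrite addr_ge0 ?powR_ge0.
apply: (@le_integrable _ (measurableTypeR R) _ _ _ _ _
  (EFin \o (fun x => C gam * x `^ a + C a * (1 - x) `^ gam))) => //.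
- exact: measurable_jacobi_weight_EFin.
- move=> x; rewrite /= in_itv/= => /andP[x0 x1]; rewrite lee_fin.
  rewrite !ger0_norm ?jacobi_weight_ge0 ?addr_ge0 ?mulr_ge0 ?powR_ge0//.
  rewrite /jacobi_weight; have [x2|x2] := leP x 2^-1.
    rewrite -[leLHS]addr0 lerD ?mulr_ge0 ?powR_ge0// mulrC.
    by rewrite ler_wpM2r ?powR_ge0// powR_upper_half_le//; lra.
  rewrite -[leLHS]add0r lerD ?mulr_ge0 ?powR_ge0//.
  by rewrite ler_wpM2r ?powR_ge0// powR_upper_half_le//; lra.
- rewrite (_ : _ \o _ = ((fun x => (C gam)%:E * (x `^ a)%:E) \+
                        (fun x => (C a)%:E * ((1 - x) `^ gam)%:E))%E)//.
  apply: (@integrableD _ (measurableTypeR R)) => //;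
    apply: (@integrableZl _ (measurableTypeR R)) => //.
  + exact: integrable_powR.
  + exact: integrable_onem_powR.
Qed.

Lemma integrable_jacobi_weight a gam : -1 < a -> -1 < gam ->
  mu.-integrable `[0, 1] (EFin \o jacobi_weight a gam).
Proof.
move=> a1 g1; apply/integrableP; split.
  exact: measurable_jacobi_weight_EFin.
have [_ fin] := integrableP _ _ _ (integrable_jacobi_weight_oo a1 g1).
rewrite integral_itv_bndoo//; apply: measurableT_comp => //.
exact: measurable_jacobi_weight_EFin.
Qed.

End JacobiWeight.

(** * The substitution t = x^2 *)

Section SquareSubstitution.
Context {R : realType}.
Local Notation mu := (@lebesgue_measure R).
Implicit Types (a b e gam x y : R).

(** The change of variables holds on [u, 1 - u] with image
    [u^2, (1 - u)^2], where f is continuous up to the ends.  Both families of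
    intervals exhaust ]0, 1[, so both sides converge to the stated integrals. *)
Lemma ge0_integral_sqr_subst (f : R -> R) :
  {in `]0, 1[, forall x, 0 <= f x} -> {in `]0, 1[, continuous f} ->
  (\int[mu]_(x in `]0%R, 1%R[) (f x)%:E =
   \int[mu]_(x in `]0%R, 1%R[) (f (x ^+ 2) * (2 * x))%:E)%E.
Proof.
move=> f0 cf.
have sqr01 x : x \in `]0, 1[ -> x ^+ 2 \in `]0, 1[.
  rewrite !in_itv/= => /andP[x0 x1]; rewrite exprn_gt0//=.
  by rewrite expr_lt1// ltW.
have csqr x : {for x, continuous (fun t : R => t ^+ 2)}.
  exact: exprn_continuous.
pose g x := f (x ^+ 2) * (2 * x).
have cg : {in `]0, 1[, continuous g}.
  move=> x x01; apply: cvgM.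
    apply: (@continuous_comp _ _ _ (fun t : R => t ^+ 2) f x); first exact: csqr.
    by apply: cf; exact: sqr01.
  by apply: cvgM; [exact: cvg_cst|exact: cvg_id].
have mf : measurable_fun (`]0, 1[ : set R) (EFin \o f).
  apply/measurable_EFinP; apply: open_continuous_measurable_fun => //.
  by move=> x /set_mem; exact: cf.
have mg : measurable_fun (`]0, 1[ : set R) (EFin \o g).
  apply/measurable_EFinP; apply: open_continuous_measurable_fun => //.
  by move=> x /set_mem; exact: cg.
pose u : R^nat := inner_seq; pose v : R^nat := fun n => 1 - inner_seq n.
have u0 n : 0 < u n by exact: inner_seq_gt0.
have uv n : u n < v n by rewrite /u /v; have := @inner_seq_lt R n; lra.
have v1 n : v n < 1 by rewrite ltrBlDr ltrDl inner_seq_gt0.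
have v0 n : 0 < v n by exact: lt_trans (u0 n) (uv n).
have niu : nonincreasing_seq u by exact: nonincreasing_inner_seq.
have ndv : nondecreasing_seq v by move=> m n mn; rewrite lerB//; exact: niu.
have cu : u @ \oo --> 0 by exact: cvg_inner_seq.
have cv : v @ \oo --> (1 : R).
  by rewrite -[X in _ --> X]subr0; apply: cvgB; [exact: cvg_cst|exact: cu].
have sqr_le x y : 0 < x -> x <= y -> x ^+ 2 <= y ^+ 2.
  by move=> x0 xy; rewrite lerXn2r// nnegrE ?(ltW x0)// (le_trans (ltW x0) xy).
have cg' := @ge0_cvg_integral_oo R (EFin \o g) 0 1 _ _ niu ndv cu cv u0 v1 mg _.
have cf' := @ge0_cvg_integral_oo R (EFin \o f) 0 1
  (fun n => u n ^+ 2) (fun n => v n ^+ 2) _ _ _ _ _ _ mf f0.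
rewrite -(cvg_lim _ (cf' _ _ _ _ _ _))//; last 6 first.
- by move=> m n mn; apply: sqr_le => //; exact: niu.
- by move=> m n mn; apply: sqr_le => //; exact: ndv.
- by rewrite -[X in _ --> X](mulr0 0); exact: (cvgM cu cu).
- by rewrite -[X in _ --> X](mulr1 1); exact: (cvgM cv cv).
- by move=> n; rewrite exprn_gt0.
- by move=> n; rewrite expr_lt1// ltW.
rewrite -(cvg_lim _ (cg' _))//; last first.
  move=> x x01; rewrite lee_fin mulr_ge0 ?f0 ?sqr01//.
  by move: x01; rewrite in_itv/= => /andP[x0 _]; rewrite mulr_ge0// ltW.
congr (lim _); congr (_ @ \oo); apply/funext => n.
have dsqr x : is_derive x 1 (fun t : R => t ^+ 2) (2 * x).
  have := @is_deriveM _ _ id id x 1 _ _ (is_derive_id x 1) (is_derive_id x 1).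
  by move/is_derive_eq; apply; rewrite -mulr2n /GRing.scale/= mulr1 mulr_natl.
have der : (fun t : R => t ^+ 2)^`()%classic = (fun x => 2 * x).
  by apply/funext => x; rewrite derive1E; have [_ ->] := dsqr x.
rewrite (@integration_by_substitution_increasing _ (fun t => t ^+ 2) f)//.
- by apply: eq_integral => x _; rewrite /g/= der.
- exact: ltW.
- move=> x y; rewrite !in_itv/= => /andP[ux _] /andP[uy _] xy.
  have x0 : 0 <= x by exact: le_trans (ltW (u0 n)) ux.
  by rewrite ltr_pXn2r ?nnegrE// (le_trans x0 (ltW xy)).
- move=> x _; rewrite der; apply: cvgM; [exact: cvg_cst|exact: cvg_id].
- rewrite der; apply/cvg_ex; exists (2 * u n); apply: cvg_at_right_filter.
  by apply: cvgM; [exact: cvg_cst|exact: cvg_id].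
- rewrite der; apply/cvg_ex; exists (2 * v n); apply: cvg_at_left_filter.
  by apply: cvgM; [exact: cvg_cst|exact: cvg_id].
- by apply: (@continuous_is_derive_itv _ (fun x => 2 * x)).
- apply: continuous_in_subspaceT => x /set_mem/=; rewrite in_itv/= => /andP[ux xv].
  apply: cf; rewrite in_itv/= (lt_le_trans _ ux) ?exprn_gt0//=.
  by rewrite (le_lt_trans xv)// expr_lt1// ltW.
Qed.

End SquareSubstitution.

(** * The symmetric weight *)

Section SymWeight.
Context {R : realType}.
Local Notation mu := (@lebesgue_measure R).
Implicit Types (a b e gam x y : R).

Lemma measurable_sym_weight a gam : measurable_fun [set: R] (sym_weight a gam).
Proof.
apply: measurable_funM.
  apply: (@measurableT_comp _ _ _ _ _ _ (fun t : R => t `^ (2 * a + 1))).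
    exact: measurable_powR.
  exact: normr_measurable.
apply: (@measurableT_comp _ _ _ _ _ _ (fun t : R => t `^ gam)).
  exact: measurable_powR.
by apply: measurable_funB => //; exact: exprn_measurable.
Qed.

Lemma measurable_sym_weight_EFin a gam (D : set R) :
  measurable_fun D (EFin \o sym_weight a gam).
Proof.
by apply/measurable_EFinP; apply: measurable_funTS; exact: measurable_sym_weight.
Qed.

Lemma sym_weight_ge0 a gam x : 0 <= sym_weight a gam x.
Proof. by rewrite mulr_ge0 ?powR_ge0. Qed.

Lemma sym_weightN a gam x : sym_weight a gam (- x) = sym_weight a gam x.
Proof. by rewrite /sym_weight normrN sqrrN. Qed.

Lemma sqr_subst_jacobi_weight a gam x : 0 < x -> x < 1 ->
  jacobi_weight a gam (x ^+ 2) * (2 * x) = 2 * sym_weight a gam x.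
Proof.
move=> x0 x1; rewrite /jacobi_weight /sym_weight (gtr0_norm x0).
rewrite powRD; last by rewrite (gt_eqF x0) implybT.
rewrite powRr1 ?ltW// powRrM powR_mulrn ?ltW//.
by ring.
Qed.

(** Lebesgue measure is its own push-forward under negation. *)
Lemma ge0_integral_opp (f : R -> \bar R) (D : set R) : measurable D ->
  measurable_fun [set: R] f -> (forall r, 0 <= f r)%E ->
  (\int[mu]_(r in D) f r = \int[mu]_(r in -%R @^-1` D) f (- r)%R)%E.
Proof.
move=> mD mf f0.
rewrite -(@ge0_integral_pushforward _ _ (measurableTypeR R) (measurableTypeR R)
  _ -%R _ mu D f)//.
- by apply: eq_measure_integral => //= A mA AS; exact/esym/lebesgue_measureN.
- exact: measurable_funTS.
Qed.

(** By symmetry the left side is twice the integral over ]0, 1[, and twice the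
    symmetric weight is the Jacobi weight at x^2 times the Jacobian 2 x. *)
Lemma integral_sym_weight a gam : -1 < a -> -1 < gam ->
  (\int[mu]_(x in `[(-1)%R, 1%R]) (sym_weight a gam x)%:E =
   \int[mu]_(x in `[0%R, 1%R]) (jacobi_weight a gam x)%:E)%E.
Proof.
move=> a1 g1.
have ms D := @measurable_sym_weight_EFin a gam D.
have s0 x : (0 <= (sym_weight a gam x)%:E)%E by rewrite lee_fin sym_weight_ge0.
have -> : `[(-1), 1]%classic = `[(-1), 0] `|` `]0, 1] :> set R.
  by rewrite -itv_bndbnd_setU// bnd_simp.
rewrite ge0_integral_setU//=; last 2 first.
- exact: ms.
- by apply/disj_setPS => x [] /=; rewrite !in_itv/=; lra.
rewrite (@ge0_integral_opp (fun x => (sym_weight a gam x)%:E) `[(-1), 0])//.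
rewrite opp_preimage_itvbndbnd/= oppr0 opprK.
under eq_integral do rewrite sym_weightN.
have oo l r f := @integral_itv_bndoo R 0 1 f l r.
rewrite (oo true false _ (ms _)) (oo false false _ (ms _)).
rewrite (oo true false _ (@measurable_jacobi_weight_EFin _ a gam _)).
rewrite -mule2n -mule_natl -(ge0_integralZl mu (measurable_itv _) (ms _))//;
  last first.
  by move=> x _; exact: s0.
rewrite [RHS]ge0_integral_sqr_subst.
- apply: eq_integral => x; rewrite inE/= in_itv/= => /andP[x0 x1].
  by rewrite sqr_subst_jacobi_weight.
- by move=> x _; exact: jacobi_weight_ge0.
- move=> x; rewrite in_itv/= => /andP[x0 x1].
  by apply: cvgM; [exact: continuous_powR|exact: continuous_onem_powR].
Qed.

Lemma integrable_sym_weight a gam : -1 < a -> -1 < gam ->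
  mu.-integrable `[(-1), 1] (EFin \o sym_weight a gam).
Proof.
move=> a1 g1; apply/integrableP; split.
  exact: measurable_sym_weight_EFin.
have [_ fin] := integrableP _ _ _ (integrable_jacobi_weight a1 g1).
under eq_integral do rewrite gee0_abs ?lee_fin ?sym_weight_ge0//.
rewrite integral_sym_weight//; apply: le_lt_trans fin.
have mj := @measurable_jacobi_weight_EFin R a gam `[0, 1].
apply: ge0_le_integral => //.
- by move=> x _; rewrite lee_fin jacobi_weight_ge0.
- exact: measurableT_comp.
- by move=> x _; exact: lee_abs.
Qed.

End SymWeight.

(** * Integrals of polynomials against the weights *)

Section Moments.
Context {R : realType}.
Local Notation mu := (@lebesgue_measure R).
Implicit Types (a b e gam x y : R) (p q : {poly R}).

Lemma integrable_horner_weight p (w : R -> R) a b :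
  mu.-integrable `[a, b] (EFin \o w) ->
  mu.-integrable `[a, b] (EFin \o (fun x => p.[x] * w x)).
Proof.
move=> iw; apply: (@integrableMr _ (measurableTypeR R) _ mu) iw => //.
  apply: measurable_funTS; apply: continuous_measurable_fun.
  exact: continuous_horner.
have cp : {within `[a, b], continuous (horner p)}.
  by apply: continuous_subspaceT; exact: continuous_horner.
have /compact_bounded[M [_ mrt]] := continuous_compact cp (@segment_compact _ a b).
by exists M; split; rewrite ?num_real // => t Mt y ys; apply: (mrt t Mt); exists y.
Qed.

Definition jacobi_int a gam p : R :=
  \int[mu]_(x in `[0, 1]) (p.[x] * jacobi_weight a gam x).

Definition sym_int a gam p : R :=
  \int[mu]_(x in `[-1, 1]) (p.[x] * sym_weight a gam x).

Section Linearity.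
Variables (a gam : R).
Hypotheses (a1 : -1 < a) (g1 : -1 < gam).

Let ij p := integrable_horner_weight p (integrable_jacobi_weight a1 g1).
Let isym p := integrable_horner_weight p (integrable_sym_weight a1 g1).

Lemma jacobi_int_linear (c : R) p q :
  jacobi_int a gam (c *: p + q) = c * jacobi_int a gam p + jacobi_int a gam q.
Proof.
rewrite /jacobi_int -RintegralZl// -RintegralD//.
  by apply: eq_Rintegral => x _; rewrite hornerD hornerZ mulrDl -mulrA.
exact: (@integrableZl _ (measurableTypeR R) _ mu _ (measurable_itv _) c _ (ij p)).
Qed.

Lemma sym_int_linear (c : R) p q :
  sym_int a gam (c *: p + q) = c * sym_int a gam p + sym_int a gam q.
Proof.
rewrite /sym_int -RintegralZl// -RintegralD//.
  by apply: eq_Rintegral => x _; rewrite hornerD hornerZ mulrDl -mulrA.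
exact: (@integrableZl _ (measurableTypeR R) _ mu _ (measurable_itv _) c _ (isym p)).
Qed.

Lemma sym_int_opp p q : (forall x, q.[x] = p.[- x]) ->
  sym_int a gam q = sym_int a gam p.
Proof.
move=> qp; pose f x := (p.[x] * sym_weight a gam x)%:E.
have fN x : f (- x) = (q.[x] * sym_weight a gam x)%:E.
  by rewrite /f -qp sym_weightN.
rewrite /sym_int /Rintegral -/f; congr fine.
under eq_integral do rewrite -fN.
transitivity (\int[pushforward mu (-%R : _ -> measurableTypeR R)]_(x in
    `[(-1)%R, 1%R]) f x)%E; last first.
  by apply: eq_measure_integral => //= A mA AS; exact/lebesgue_measureN.
rewrite integral_pushforward//.
- by rewrite opp_preimage_itvbndbnd opprK.
- apply/measurable_EFinP; apply: measurable_funM.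
    by apply: continuous_measurable_fun; exact: continuous_horner.
  exact: measurable_sym_weight.
- rewrite opp_preimage_itvbndbnd opprK.
  rewrite (_ : f \o _ = EFin \o (fun x => q.[x] * sym_weight a gam x))//.
  by apply/funext => x /=; rewrite fN.
Qed.

Lemma sym_int_odd p : (forall x, p.[- x] = - p.[x]) -> sym_int a gam p = 0.
Proof.
move=> podd; have : sym_int a gam (- p) = sym_int a gam p.
  by apply: sym_int_opp => x; rewrite podd hornerN.
have := sym_int_linear (-1) p 0; have := sym_int_linear 1 0 0.
by rewrite scale1r scaleN1r !addr0; lra.
Qed.

Lemma jacobi_int_sqr_ge0 p : 0 <= jacobi_int a gam (p ^+ 2).
Proof.
apply: Rintegral_ge0 => x _.
by rewrite horner_exp mulr_ge0 ?sqr_ge0 ?jacobi_weight_ge0.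
Qed.

Lemma finite_roots p : p != 0 -> finite_set [set x | root p x].
Proof.
move=> p0; apply/not_notP => /(infinite_set_fset (size p)) [B Broot].
apply/negP; rewrite -ltnNge; apply: max_poly_roots => //.
  by apply/allP => x xB; exact: Broot.
exact: finmap.fset_uniq.
Qed.

(** A vanishing integral of the nonnegative function p^2 w forces it to vanish
    almost everywhere.  The weight is positive on ]0, 1[, so that interval
    would be covered, up to a null set, by the finitely many roots of p. *)
Lemma jacobi_int_sqr_eq0 p : jacobi_int a gam (p ^+ 2) = 0 -> p = 0.
Proof.
move=> I0; apply/eqP; apply: contraT => p0.
pose f x := ((p ^+ 2).[x] * jacobi_weight a gam x)%:E.
have f0 x : (0 <= f x)%E.
  by rewrite lee_fin horner_exp mulr_ge0 ?sqr_ge0 ?jacobi_weight_ge0.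
have /integrableP[mf fin] := ij (p ^+ 2).
have : (\int[mu]_(x in `[0%R, 1%R]) `|f x| = 0)%E.
  under eq_integral do rewrite gee0_abs//.
  rewrite -[LHS]fineK; first by rewrite [fine _]I0.
  by apply: integrable_fin_num => //; exact: ij.
move/ae_eq_integral_abs => /(_ (measurable_itv _) mf) [N [mN N0 sub]].
have croots : countable [set x | root p x].
  by apply: finite_set_countable; exact: finite_roots.
have mroots : measurable ([set x | root p x] : set R).
  by apply: countable_measurable => // x; exact: measurable_set1.
have : mu `]0, 1[ = 0%E.
  apply: (@subset_measure0 _ _ _ mu _ (N `|` [set x | root p x])) => //.
  - exact: measurableU.
  - move=> x /=; rewrite in_itv/= => /andP[x0 x1].
    have [rx|nrx] := boolP (root p x); first by right.
    left; apply: sub => /= fx0.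
    have x01 : x \in `[0, 1] by rewrite in_itv/= !ltW.
    have /eqP := EFin_inj (fx0 x01); rewrite mulf_eq0 horner_exp expf_eq0/=.
    rewrite -/(root p x) (negbTE nrx)/= /jacobi_weight mulf_eq0.
    by rewrite !gt_eqF ?powR_gt0// subr_gt0.
  - rewrite -N0; apply: measureU0 => //.
    exact: countable_lebesgue_measure0.
rewrite lebesgue_measure_itv/= lte_fin ltr01 => /eqP.
by rewrite -EFinB eqe subr0 oner_eq0.
Qed.

End Linearity.

End Moments.

(** * Even and odd polynomials *)

Section EvenMoments.
Context {R : realType}.
Local Notation mu := (@lebesgue_measure R).
Implicit Types (a gam : R) (p : {poly R}).

Lemma jacobi_int_mulX a gam p : -1 < a ->
  jacobi_int a gam ('X * p) = jacobi_int (a + 1) gam p.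
Proof.
move=> a1; apply: eq_Rintegral => x.
rewrite inE/= in_itv/= => /andP[x0 _].
rewrite hornerM hornerX /jacobi_weight.
suff -> : x `^ (a + 1) = x * x `^ a by ring.
by rewrite -{2}[x](powRr1 x0) -powRD 1?addrC// gt_eqF//; lra.
Qed.

Lemma sym_int_mulX2 a gam p : -1 < a ->
  sym_int a gam ('X ^+ 2 * p) = sym_int (a + 1) gam p.
Proof.
move=> a1; apply: eq_Rintegral => x _.
rewrite hornerM hornerXn /sym_weight.
suff -> : `|x| `^ (2 * (a + 1) + 1) = x ^+ 2 * `|x| `^ (2 * a + 1).
  by ring.
rewrite -real_normK ?num_real// -powR_mulrn// -powRD; last first.
  by apply/implyP => /eqP; lra.
by congr (_ `^ _); ring.
Qed.

Lemma sym_int1 a gam : -1 < a -> -1 < gam ->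
  sym_int a gam 1 = jacobi_int a gam 1.
Proof.
move=> a1 g1; have one (w : R -> R) D :
    \int[mu]_(x in D) ((1 : {poly R}).[x] * w x) = \int[mu]_(x in D) w x.
  by apply: eq_Rintegral => x _; rewrite hornerC mul1r.
by rewrite /sym_int /jacobi_int !one /Rintegral integral_sym_weight.
Qed.

(** Induction on p with a generalized: removing a factor X from p removes a
    factor X^2 from p(X^2), and both raise the parameter a by one.  This
    reduces the substitution for polynomials, which may change sign, to the
    total masses of the two positive weights. *)
Lemma sym_int_comp_sqr a gam p : -1 < a -> -1 < gam ->
  sym_int a gam (p \Po 'X^2) = jacobi_int a gam p.
Proof.
elim/poly_ind: p a => [a a1 g1|p c IH a a1 g1].
  rewrite comp_poly0; have := jacobi_int_linear a1 g1 1 0 0.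
  by have := sym_int_linear a1 g1 1 0 0; rewrite scale1r addr0; lra.
rewrite comp_polyD comp_polyM comp_polyX comp_polyC.
rewrite ![_ * 'X]mulrC [_ * 'X^2]mulrC.
have addC (q : {poly R}) : q + c%:P = c *: 1 + q by rewrite alg_polyC addrC.
rewrite (addC ('X * p)) (addC ('X^2 * _)) (sym_int_linear a1 g1).
rewrite (jacobi_int_linear a1 g1).
have a1' : -1 < a + 1 by lra.
rewrite (jacobi_int_mulX _ p a1) (sym_int_mulX2 _ (p \Po _) a1) (IH _ a1' g1).
by rewrite (sym_int1 a1 g1).
Qed.

Lemma sym_int_mulX_comp_sqr a gam p : -1 < a -> -1 < gam ->
  sym_int a gam ('X * (p \Po 'X^2)) = 0.
Proof.
move=> a1 g1; apply: sym_int_odd => // x.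
by rewrite !hornerM !hornerX !horner_comp !hornerXn sqrrN mulNr.
Qed.

Lemma jacobi_const_gt0 a gam : -1 < a -> -1 < gam -> 0 < jacobi_const a gam.
Proof.
move=> a1 g1; have -> : jacobi_const a gam = (jacobi_int a gam (1 ^+ 2))^-1.
  congr (_^-1); apply: eq_Rintegral => x _.
  by rewrite expr1n hornerC mul1r.
rewrite invr_gt0 lt_neqAle jacobi_int_sqr_ge0// andbT eq_sym.
by apply/eqP => /(jacobi_int_sqr_eq0 a1 g1)/eqP; rewrite oner_eq0.
Qed.

End EvenMoments.

(** * Substitutions and derivatives of bivariate polynomials *)

Section BipolyAlgebra.
Context {R : realType}.
Implicit Types (f g h p q : bipoly R) (u v : {poly R}) (c : R).

Lemma mpolyX_pair (m : multinom 2) :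
  mpolyX R m = polX ^+ m ord0 * polY ^+ m ord_max.
Proof.
rewrite mpolyXE_id big_ord_recl big_ord1.
by rewrite (_ : lift ord0 ord0 = ord_max :> 'I_2)//; apply/val_inj.
Qed.

Lemma bipoly_span_ind (P : bipoly R -> Prop) k f : (msize f <= k)%N ->
  P 0 -> (forall c p, P p -> P (c *: p)) ->
  (forall p q, P p -> P q -> P (p + q)) ->
  (forall i j, (i + j < k)%N -> P (polX ^+ i * polY ^+ j)) -> P f.
Proof.
move=> fk P0 PZ PD PXY; rewrite (mpolywE fk); apply: big_ind => // m _.
apply: PZ; rewrite mpolyX_pair; apply: PXY.
have := bmdeg m; rewrite mdegE big_ord_recl big_ord1.
by rewrite (_ : lift ord0 ord0 = ord_max :> 'I_2)//; apply/val_inj.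
Qed.

Lemma bipoly_alg_ind (P : bipoly R -> Prop) f :
  P 1 -> P polX -> P polY -> (forall c p, P p -> P (c *: p)) ->
  (forall p q, P p -> P q -> P (p + q)) ->
  (forall p q, P p -> P q -> P (p * q)) -> P f.
Proof.
move=> P1 PX PY PZ PD PM; apply: (bipoly_span_ind (leqnn (msize f))) => //.
  by rewrite -(scale0r 1); exact: PZ.
have Pexp p n : P p -> P (p ^+ n).
  by move=> Pp; elim: n => [|n IH]; rewrite ?expr0// exprS; exact: PM.
by move=> i j _; apply: PM; exact: Pexp.
Qed.

(** Restrictions to the edges are [subst2 'X e] and [subst2 e 'X] with e a
    constant polynomial. *)
Definition subst2 u v f : {poly R} := mmap (@polyC R) (tnth [tuple u; v]) f.

Lemma subst2D u v : {morph subst2 u v : f g / f + g}.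
Proof. by move=> f g; exact: mmapD. Qed.

Lemma subst2M u v : {morph subst2 u v : f g / f * g}.
Proof. by move=> f g; exact: rmorphM. Qed.

Lemma subst2_1 u v : subst2 u v 1 = 1.
Proof. exact: rmorph1. Qed.

Lemma subst2Z u v c f : subst2 u v (c *: f) = c *: subst2 u v f.
Proof. by rewrite /subst2 mmapZ mul_polyC. Qed.

Lemma subst2X u v : subst2 u v polX = u.
Proof. by rewrite /subst2 /polX mmapX mmap1U. Qed.

Lemma subst2Y u v : subst2 u v polY = v.
Proof. by rewrite /subst2 /polY mmapX mmap1U. Qed.

Lemma subst2B u v : {morph subst2 u v : f g / f - g}.
Proof. by move=> f g; rewrite -scaleN1r subst2D subst2Z scaleN1r. Qed.

Lemma subst2_polXY u v i j : subst2 u v (polX ^+ i * polY ^+ j) = u ^+ i * v ^+ j.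
Proof.
by rewrite subst2M; congr (_ * _);
  [elim: i => [|i IH]|elim: j => [|j IH]]; rewrite ?expr0 ?subst2_1// !exprS
  subst2M IH (subst2X, subst2Y).
Qed.

Lemma horner_subst2 u v f x : (subst2 u v f).[x] = eval2 f u.[x] v.[x].
Proof.
rewrite /subst2 /eval2 mevalE /mmap horner_sum; apply: eq_bigr => m _.
rewrite hornerM hornerC; congr (_ * _).
rewrite /mmap1 horner_prod !big_ord_recl !big_ord0 !horner_exp.
by rewrite !(tnth_nth 0).
Qed.

Lemma sqvarsD : {morph @sqvars R : f g / f + g}.
Proof. by move=> f g; exact: comp_mpolyD. Qed.

Lemma sqvarsM : {morph @sqvars R : f g / f * g}.
Proof. by move=> f g; exact: rmorphM. Qed.

Lemma sqvars1 : @sqvars R 1 = 1.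
Proof. exact: rmorph1. Qed.

Lemma sqvarsZ c f : sqvars (c *: f) = c *: sqvars f.
Proof. exact: comp_mpolyZ. Qed.

Lemma sqvarsX : @sqvars R polX = polX ^+ 2.
Proof. by rewrite /sqvars /polX comp_mpolyXU. Qed.

Lemma sqvarsY : @sqvars R polY = polY ^+ 2.
Proof. by rewrite /sqvars /polY comp_mpolyXU. Qed.

Lemma subst2_sqvars u v f : subst2 u v (sqvars f) = subst2 (u ^+ 2) (v ^+ 2) f.
Proof.
apply: (@bipoly_alg_ind
  (fun f => subst2 u v (sqvars f) = subst2 (u ^+ 2) (v ^+ 2) f)).
- by rewrite sqvars1 !subst2_1.
- by rewrite sqvarsX expr2 subst2M !subst2X.
- by rewrite sqvarsY expr2 subst2M !subst2Y.
- by move=> c p IH; rewrite sqvarsZ !subst2Z IH.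
- by move=> p q IHp IHq; rewrite sqvarsD !subst2D IHp IHq.
- by move=> p q IHp IHq; rewrite sqvarsM !subst2M IHp IHq.
Qed.

Lemma subst2_comp_poly u v w f :
  subst2 u v f \Po w = subst2 (u \Po w) (v \Po w) f.
Proof.
apply: (@bipoly_alg_ind
  (fun f => subst2 u v f \Po w = subst2 (u \Po w) (v \Po w) f)).
- by rewrite !subst2_1 comp_polyC.
- by rewrite !subst2X.
- by rewrite !subst2Y.
- by move=> c p IH; rewrite !subst2Z comp_polyZ IH.
- by move=> p q IHp IHq; rewrite !subst2D comp_polyD IHp IHq.
- by move=> p q IHp IHq; rewrite !subst2M comp_polyM IHp IHq.
Qed.

Lemma subst2_sqr_edges f :
  (subst2 'X^2 1 f = subst2 'X 1 f \Po 'X^2) *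
  (subst2 1 'X^2 f = subst2 1 'X f \Po 'X^2).
Proof. by rewrite !subst2_comp_poly !comp_polyX !comp_polyC. Qed.

Section Derivatives.
Let dxD f g : dx (f + g) = dx f + dx g. Proof. exact: mderivD. Qed.
Let dyD f g : dy (f + g) = dy f + dy g. Proof. exact: mderivD. Qed.
Let dxM f g : dx (f * g) = dx f * g + f * dx g. Proof. exact: mderivM. Qed.
Let dyM f g : dy (f * g) = dy f * g + f * dy g. Proof. exact: mderivM. Qed.
Let dxZ c f : dx (c *: f) = c *: dx f. Proof. exact: mderivZ. Qed.
Let dyZ c f : dy (c *: f) = c *: dy f. Proof. exact: mderivZ. Qed.
Let dxy f : dx (dy f) = dy (dx f). Proof. exact: mderiv_comm. Qed.
Let dx1 : dx (1 : bipoly R) = 0. Proof. exact: mderivC. Qed.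
Let dy1 : dy (1 : bipoly R) = 0. Proof. exact: mderivC. Qed.
Let dx0 : dx (0 : bipoly R) = 0. Proof. exact: mderiv0. Qed.
Let dy0 : dy (0 : bipoly R) = 0. Proof. exact: mderiv0. Qed.
Let dxX : dx (polX : bipoly R) = 1.
Proof.
rewrite /dx /polX mderivX mnm1E eqxx scale1r.
rewrite (_ : mnm_sub _ _ = mnm0) ?mpolyX0//.
by apply/mnmP => i; rewrite mnmBE mnm0E subnn.
Qed.
Let dyY : dy (polY : bipoly R) = 1.
Proof.
rewrite /dy /polY mderivX mnm1E eqxx scale1r.
rewrite (_ : mnm_sub _ _ = mnm0) ?mpolyX0//.
by apply/mnmP => i; rewrite mnmBE mnm0E subnn.
Qed.
Let dyX : dy (polX : bipoly R) = 0.
Proof. by rewrite /dy /polX mderivX mnm1E /= scale0r. Qed.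
Let dxY : dx (polY : bipoly R) = 0.
Proof. by rewrite /dx /polY mderivX mnm1E /= scale0r. Qed.
Let sqvars0 : sqvars (0 : bipoly R) = 0.
Proof. exact: comp_mpoly0. Qed.

Lemma dx_sqvars f : dx (sqvars f) = 2 *: (polX * sqvars (dx f)).
Proof.
apply: (@bipoly_alg_ind (fun f => dx (sqvars f) = 2 *: (polX * sqvars (dx f)))).
- by rewrite sqvars1 dx1 sqvars0 mulr0 scaler0.
- by rewrite sqvarsX expr2 dxM dxX sqvars1 mulr1 mul1r scaler_nat mulr2n.
- by rewrite sqvarsY expr2 dxM dxY sqvars0 !(mulr0,mul0r,addr0,scaler0).
- move=> c p IH; rewrite sqvarsZ (dxZ c (sqvars p)) IH dxZ sqvarsZ.
  by rewrite -scalerAr !scalerA mulrC.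
- by move=> p q IHp IHq; rewrite sqvarsD !dxD sqvarsD IHp IHq mulrDr scalerDr.
- move=> p q IHp IHq; rewrite sqvarsM !dxM sqvarsD !sqvarsM IHp IHq.
  by rewrite mulrDr scalerDr -!scalerAl -!scalerAr !mulrA (mulrC (sqvars p)).
Qed.

Lemma dy_sqvars f : dy (sqvars f) = 2 *: (polY * sqvars (dy f)).
Proof.
apply: (@bipoly_alg_ind (fun f => dy (sqvars f) = 2 *: (polY * sqvars (dy f)))).
- by rewrite sqvars1 dy1 sqvars0 mulr0 scaler0.
- by rewrite sqvarsX expr2 dyM dyX sqvars0 !(mulr0,mul0r,addr0,scaler0).
- by rewrite sqvarsY expr2 dyM dyY sqvars1 mulr1 mul1r scaler_nat mulr2n.
- move=> c p IH; rewrite sqvarsZ (dyZ c (sqvars p)) IH dyZ sqvarsZ.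
  by rewrite -scalerAr !scalerA mulrC.
- by move=> p q IHp IHq; rewrite sqvarsD !dyD sqvarsD IHp IHq mulrDr scalerDr.
- move=> p q IHp IHq; rewrite sqvarsM !dyM sqvarsD !sqvarsM IHp IHq.
  by rewrite mulrDr scalerDr -!scalerAl -!scalerAr !mulrA (mulrC (sqvars p)).
Qed.

(** The piece x^d1 y^d2 f(x^2, y^2) of parity (d1, d2). *)
Definition sqlift (d1 d2 : bool) f : bipoly R :=
  polX ^+ d1 * polY ^+ d2 * sqvars f.

Lemma subst2_sqlift u v (d1 d2 : bool) f :
  subst2 u v (sqlift d1 d2 f) =
  u ^+ d1 * v ^+ d2 * subst2 (u ^+ 2) (v ^+ 2) f.
Proof. by rewrite /sqlift subst2M subst2_polXY subst2_sqvars. Qed.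

(** Put D = dx dy and F = f(x^2, y^2), so that D F = 0.  Leibniz gives
    D (x g) = dy g + x D g and D (y g) = dx g + y D g, from which D sends x F
    to dy F, y F to dx F and x y F to F + x dx F + y dy F; a second D kills
    all of these. *)
Lemma dxxyy_sqlift (d1 d2 : bool) f : dx (dy f) = 0 ->
  dx (dx (dy (dy (sqlift d1 d2 f)))) = 0.
Proof.
move=> f0; have S0 : dx (dy (sqvars f)) = 0.
  rewrite dy_sqvars dxZ dxM dxY mul0r add0r dx_sqvars f0 sqvars0.
  by rewrite !(mulr0,scaler0).
have S1 : dy (dx (sqvars f)) = 0 by rewrite -dxy.
rewrite /sqlift; move: (sqvars f) S0 S1 => F S0 S1.
have DX g : dx (dy (polX * g)) = dy g + polX * dx (dy g).
  by rewrite dyM dyX mul0r add0r dxM dxX mul1r.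
have DY g : dx (dy (polY * g)) = dx g + polY * dx (dy g).
  by rewrite dxy dxM dxY mul0r add0r dyM dyY mul1r -dxy.
have Sx : dx (dy (dx F)) = 0 by rewrite S1 dx0.
have Sy : dx (dy (dy F)) = 0 by rewrite dxy S0 dy0.
rewrite (dxy (dy _)).
case: d1; case: d2; rewrite ?expr1 ?expr0 ?mul1r ?mulr1 -?mulrA.
- rewrite DX DY S0 mulr0 addr0 dyM dyY mul1r !dyD !dxD DY DX S0 S1 Sy dx0.
  by rewrite !(mulr0, addr0).
- by rewrite DX S0 mulr0 addr0 Sy.
- by rewrite DY S0 mulr0 addr0 Sx.
- by rewrite S0 dy0 dx0.
Qed.

End Derivatives.
End BipolyAlgebra.

(** * The two inner products *)

Section InnerProductFunctionals.
Context {R : realType}.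
Implicit Types (a b gam sigma c : R) (f g h p q : bipoly R).

(** Both inner products depend only on the product of their arguments, and
    become linear functionals of that product. *)
Definition square_fun a b gam h : R :=
  jacobi_const a gam *
    sym_int a gam (subst2 'X (-1)%:P h + subst2 'X 1 h) +
  jacobi_const b gam *
    sym_int b gam (subst2 (-1)%:P 'X h + subst2 1 'X h).

Definition wedge_fun sigma a b gam h : R :=
  jacobi_const a gam * jacobi_int a gam (subst2 'X 1 h) +
  sigma * jacobi_const b gam * jacobi_int b gam (subst2 1 'X h).

Lemma eval2M x y : {morph (fun f => eval2 f x y) : f g / f * g}.
Proof. by move=> f g; exact: mevalM. Qed.

Lemma square_ipE a b gam f g :
  square_ip a b gam f g = square_fun a b gam (f * g).
Proof.
rewrite /square_ip /square_fun; congr (_ * _ + _ * _);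
  apply: eq_Rintegral => x _; congr (_ * _);
  by rewrite hornerD !horner_subst2 hornerX !hornerC !eval2M.
Qed.

Lemma wedge_ipE sigma a b gam f g :
  wedge_ip sigma a b gam f g = wedge_fun sigma a b gam (f * g).
Proof.
rewrite /wedge_ip /wedge_fun; congr (_ * _ + _ * _);
  apply: eq_Rintegral => x _; congr (_ * _);
  by rewrite !horner_subst2 hornerX !hornerC !eval2M.
Qed.

Lemma square_fun_linear a b gam c f g : -1 < a -> -1 < b -> -1 < gam ->
  square_fun a b gam (c *: f + g) = c * square_fun a b gam f + square_fun a b gam g.
Proof.
move=> a1 b1 g1; rewrite /square_fun !subst2D !subst2Z.
have e (u v w z : {poly R}) : c *: u + w + (c *: v + z) = c *: (u + v) + (w + z).
  by rewrite scalerDr addrACA.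
have lin (k l x y z w : R) :
  k * (c * x + y) + l * (c * z + w) = c * (k * x + l * z) + (k * y + l * w).
  by ring.
by rewrite !e (sym_int_linear a1 g1) (sym_int_linear b1 g1) lin.
Qed.

Lemma jacobi_int0 a gam : -1 < a -> -1 < gam -> jacobi_int a gam 0 = 0.
Proof.
move=> a1 g1; have := jacobi_int_linear a1 g1 1 0 0.
by rewrite scale1r addr0 mul1r; lra.
Qed.

Lemma sym_int0 a gam : -1 < a -> -1 < gam -> sym_int a gam 0 = 0.
Proof.
move=> a1 g1; have := sym_int_linear a1 g1 1 0 0.
by rewrite scale1r addr0 mul1r; lra.
Qed.

Lemma subst2_square_ideal (u v : {poly R}) h : (u ^+ 2 == 1) || (v ^+ 2 == 1) ->
  square_ideal h -> subst2 u v h = 0.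
Proof.
move=> uv [k ->].
rewrite !subst2M !subst2B !subst2_1 !expr2 !subst2M subst2X subst2Y -!expr2.
by case/orP: uv => /eqP ->; rewrite subrr ?mul0r !mulr0.
Qed.

Lemma subst2_wedge_ideal (u v : {poly R}) h : (u == 1) || (v == 1) ->
  wedge_ideal h -> subst2 u v h = 0.
Proof.
move=> uv [k ->]; rewrite !subst2M !subst2B !subst2_1 subst2X subst2Y.
by case/orP: uv => /eqP ->; rewrite subrr ?mul0r !mulr0.
Qed.

Lemma square_fun_ideal a b gam h : -1 < a -> -1 < b -> -1 < gam ->
  square_ideal h -> square_fun a b gam h = 0.
Proof.
move=> a1 b1 g1 Ih.
by rewrite /square_fun !(@subst2_square_ideal _ _ h) -?polyC_exp ?sqrrN
  ?expr1n ?eqxx ?orbT//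
  !addr0 !sym_int0// !mulr0 addr0.
Qed.

Lemma wedge_fun_ideal sigma a b gam h : -1 < a -> -1 < b -> -1 < gam ->
  wedge_ideal h -> wedge_fun sigma a b gam h = 0.
Proof.
move=> a1 b1 g1 Ih.
by rewrite /wedge_fun !(@subst2_wedge_ideal _ _ h) ?eqxx ?orbT//
  !jacobi_int0// !mulr0 addr0.
Qed.

(** Parities add modulo 2; the variables occurring in both factors contribute
    a square, which is absorbed as a first power inside the argument of
    [sqvars]. *)
Lemma sqliftM (d1 d2 e1 e2 : bool) f g :
  sqlift d1 d2 f * sqlift e1 e2 g =
  sqlift (d1 (+) e1) (d2 (+) e2)
    (polX ^+ (d1 && e1) * polY ^+ (d2 && e2) * (f * g)).
Proof.
rewrite /sqlift !sqvarsM.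
have sX (d : bool) : sqvars (polX ^+ d : bipoly R) = (polX ^+ 2) ^+ d.
  by case: d; rewrite ?expr0 ?sqvars1// expr1 sqvarsX.
have sY (d : bool) : sqvars (polY ^+ d : bipoly R) = (polY ^+ 2) ^+ d.
  by case: d; rewrite ?expr0 ?sqvars1// expr1 sqvarsY.
have key (S : comNzRingType) (x y F G : S) :
    x ^+ d1 * y ^+ d2 * F * (x ^+ e1 * y ^+ e2 * G) =
    x ^+ (d1 (+) e1) * y ^+ (d2 (+) e2) *
    ((x ^+ 2) ^+ (d1 && e1) * (y ^+ 2) ^+ (d2 && e2) * (F * G)).
  by case: d1; case: d2; case: e1; case: e2; rewrite /= ?expr1 ?expr0; ring.
by rewrite sX sY key.
Qed.

(** If d2 = 1 the contributions of the edges y = 1 and y = -1 cancel; if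
    d1 = 1 the integrand on each of these edges is odd when d2 = 0.  The
    vertical edges behave in the same way with the roles exchanged. *)
Lemma square_fun_odd a b gam (d1 d2 : bool) h : -1 < a -> -1 < b -> -1 < gam ->
  d1 || d2 -> square_fun a b gam (sqlift d1 d2 h) = 0.
Proof.
move=> a1 b1 g1 d12; rewrite /square_fun !subst2_sqlift.
have sq1 : (-1)%:P ^+ 2 = 1 :> {poly R} by rewrite -polyC_exp sqrrN expr1n.
rewrite sq1 !expr1n !subst2_sqr_edges.
have NN (p q : {poly R}) : p * (-1)%:P * q + p * q = 0.
  by rewrite polyCN; ring.
have NN1 (q : {poly R}) : (-1)%:P * q + q = 0 by rewrite polyCN; ring.
have N1 (p q : {poly R}) : p * q + p * q = p * (2 *: q).
  by rewrite scaler_nat mulr2n mulrDr.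
case: d1 d12; case: d2 => //= _; rewrite ?expr1 ?expr0 ?mulr1 ?mul1r.
- rewrite [(-1)%:P * _]mulrC !NN !sym_int0//.
  by rewrite !mulr0 addr0.
- rewrite NN1 sym_int0// mulr0 addr0 N1 -comp_polyZ.
  by rewrite sym_int_mulX_comp_sqr// mulr0.
- rewrite NN1 sym_int0// mulr0 add0r N1 -comp_polyZ.
  by rewrite sym_int_mulX_comp_sqr// mulr0.
Qed.

Lemma shift_gtN1 a (d : bool) : -1 < a -> -1 < Defs.shift a d.
Proof. by rewrite /Defs.shift; case: d => /=; lra. Qed.

Lemma wedge_sigma_gt0 a b gam (d1 d2 : bool) : -1 < a -> -1 < b -> -1 < gam ->
  0 < wedge_sigma a b gam d1 d2.
Proof.
move=> a1 b1 g1.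
by rewrite divr_gt0// mulr_gt0// jacobi_const_gt0// shift_gtN1.
Qed.

Lemma jacobi_int_shift a gam (d : bool) (p : {poly R}) : -1 < a ->
  jacobi_int a gam ('X ^+ d * p) = jacobi_int (Defs.shift a d) gam p.
Proof.
move=> a1; rewrite /Defs.shift; case: d; rewrite ?expr1 ?expr0.
  exact: jacobi_int_mulX.
by rewrite mul1r addr0.
Qed.

(** The factor 2 counts the pairs of opposite edges; the quotient replaces the
    normalizing constant of a by the one of the shifted parameter. *)
Definition sqlift_factor a gam (d1 : bool) : R :=
  2 * (jacobi_const a gam / jacobi_const (Defs.shift a d1) gam).

(** The parameter sigma of the wedge makes the quotient of the weights of the
    two edges on the right equal to the one on the left. *)
Lemma square_fun_even a b gam (d1 d2 : bool) h :
  -1 < a -> -1 < b -> -1 < gam ->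
  square_fun a b gam (sqvars (polX ^+ d1 * polY ^+ d2 * h)) =
  sqlift_factor a gam d1 *
  wedge_fun (wedge_sigma a b gam d1 d2) (Defs.shift a d1) (Defs.shift b d2) gam h.
Proof.
move=> a1 b1 g1.
have e2 (p : {poly R}) : p + p = 2 *: p by rewrite scaler_nat mulr2n.
rewrite /square_fun !subst2_sqvars -polyC_exp sqrrN !expr1n !e2.
rewrite !subst2_sqr_edges -!comp_polyZ !sym_int_comp_sqr//.
rewrite ![subst2 _ _ (_ * h)]subst2M !subst2_polXY !expr1n.
rewrite mulr1 mul1r !scalerAr !jacobi_int_shift//.
have a1' := shift_gtN1 d1 a1; have b1' := shift_gtN1 d2 b1.
have e t (t1 : -1 < t) (p : {poly R}) :
    jacobi_int t gam (2 *: p) = 2 * jacobi_int t gam p.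
  have := jacobi_int_linear t1 g1 2 p 0.
  by rewrite (jacobi_int0 t1 g1) !addr0.
rewrite (e _ a1') (e _ b1') /sqlift_factor /wedge_fun /wedge_sigma.
have := jacobi_const_gt0 a1' g1; have := jacobi_const_gt0 b1' g1.
have := jacobi_const_gt0 a1 g1.
move: (jacobi_const a gam) (jacobi_const b gam) (jacobi_const _ gam)
  (jacobi_const _ gam) (jacobi_int _ _ _) (jacobi_int _ _ _) => ca cb cb' ca' x y.
move=> /gt_eqF/negbT ca0 /gt_eqF/negbT cb0' /gt_eqF/negbT ca0'.
by field; rewrite ca0 cb0' ca0'.
Qed.

Lemma sqlift_factor_gt0 a gam (d1 : bool) : -1 < a -> -1 < gam ->
  0 < sqlift_factor a gam d1.
Proof.
by move=> a1 g1; rewrite mulr_gt0// divr_gt0// jacobi_const_gt0// shift_gtN1.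
Qed.

Lemma square_ip_sqlift_neq a b gam (d1 d2 e1 e2 : bool) f g :
  -1 < a -> -1 < b -> -1 < gam -> (d1, d2) != (e1, e2) ->
  square_ip a b gam (sqlift d1 d2 f) (sqlift e1 e2 g) = 0.
Proof.
move=> a1 b1 g1; rewrite xpair_eqE negb_and square_ipE sqliftM => de.
by apply: square_fun_odd => //; move: de; case: d1; case: d2; case: e1; case: e2.
Qed.

Lemma square_ip_sqlift a b gam (d1 d2 : bool) f g :
  -1 < a -> -1 < b -> -1 < gam ->
  square_ip a b gam (sqlift d1 d2 f) (sqlift d1 d2 g) =
  sqlift_factor a gam d1 *
  wedge_ip (wedge_sigma a b gam d1 d2) (Defs.shift a d1) (Defs.shift b d2) gam f g.
Proof.
move=> a1 b1 g1; rewrite square_ipE sqliftM !addbb !andbb wedge_ipE.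
by rewrite -square_fun_even// /sqlift !expr0 !mul1r.
Qed.

Definition lift_poly (z : bipoly R) (p : {poly R}) : bipoly R :=
  (map_poly (@mpolyC 2 R) p).[z].

Lemma lift_polyD z : {morph lift_poly z : p q / p + q}.
Proof. by move=> p q; rewrite /lift_poly rmorphD hornerD. Qed.

Lemma lift_polyM z : {morph lift_poly z : p q / p * q}.
Proof. by move=> p q; rewrite /lift_poly rmorphM hornerM. Qed.

Lemma lift_polyX z : lift_poly z 'X = z.
Proof. by rewrite /lift_poly map_polyX hornerX. Qed.

Lemma lift_poly0 z : lift_poly z 0 = 0.
Proof. by rewrite /lift_poly rmorph0 horner0. Qed.

Lemma lift_poly1 z : lift_poly z 1 = 1.
Proof. by rewrite /lift_poly rmorph1 hornerC. Qed.

Lemma lift_polyZ z c (p : {poly R}) : lift_poly z (c *: p) = c *: lift_poly z p.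
Proof.
by rewrite /lift_poly -!mul_polyC rmorphM/= map_polyC hornerM hornerC mul_mpolyC.
Qed.

(** Evaluation in a quotient ring: modulo e, the variables x and y are values
    of the univariate polynomials u and v at z, hence so is any f(x, y). *)
Lemma subst2_modE (u v : {poly R}) z e f :
  (exists h, polX = lift_poly z u + h * e) ->
  (exists h, polY = lift_poly z v + h * e) ->
  exists h, f = lift_poly z (subst2 u v f) + h * e.
Proof.
move=> Xe Ye; apply: (@bipoly_alg_ind R
  (fun f => exists h, f = lift_poly z (subst2 u v f) + h * e)).
- by exists 0; rewrite subst2_1 lift_poly1 mul0r addr0.
- by rewrite subst2X.
- by rewrite subst2Y.
- move=> c p [h pE]; exists (c *: h).
  by rewrite {1}pE subst2Z scalerDr scalerAl lift_polyZ.
- move=> p q [h pE] [k qE]; exists (h + k); rewrite {1}pE {1}qE subst2D.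
  by rewrite lift_polyD mulrDl addrACA.
- move=> p q [h pE] [k qE]; exists (h * q + lift_poly z (subst2 u v p) * k).
  have {}pE : h * e = p - lift_poly z (subst2 u v p).
    by rewrite {1}pE [RHS]addrC addKr.
  have {}qE : k * e = q - lift_poly z (subst2 u v q).
    by rewrite {1}qE [RHS]addrC addKr.
  rewrite subst2M lift_polyM mulrDl mulrAC pE -mulrA qE.
  by ring.
Qed.

Lemma dvd_onem_polX f : subst2 1 'X f = 0 -> exists h, f = h * (1 - polX).
Proof.
move=> f0; have [||h fE] := @subst2_modE 1 'X polY (1 - polX) f.
- by exists (- 1); rewrite lift_poly1 mulN1r opprB addrC subrK.
- by exists 0; rewrite lift_polyX mul0r addr0.
- by exists h; rewrite {1}fE f0 lift_poly0 add0r.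
Qed.

Lemma dvd_onem_polY f : subst2 'X 1 f = 0 -> exists h, f = h * (1 - polY).
Proof.
move=> f0; have [||h fE] := @subst2_modE 'X 1 polX (1 - polY) f.
- by exists 0; rewrite lift_polyX mul0r addr0.
- by exists (- 1); rewrite lift_poly1 mulN1r opprB addrC subrK.
- by exists h; rewrite {1}fE f0 lift_poly0 add0r.
Qed.

(** Vanishing on the edge y = 1 gives a factor 1 - y.  That factor restricts
    to the nonzero polynomial 1 - X on the edge x = 1, so the cofactor itself
    vanishes there. *)
Lemma wedge_idealP f : subst2 'X 1 f = 0 -> subst2 1 'X f = 0 -> wedge_ideal f.
Proof.
move=> /dvd_onem_polY[h ->]; rewrite subst2M subst2B subst2_1 subst2Y.
move=> /eqP; rewrite mulf_eq0 => /orP[/eqP/dvd_onem_polX[k ->]|].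
  by exists k; rewrite mulrA.
rewrite subr_eq0 => /eqP/(congr1 (fun p : {poly R} => size p)).
by rewrite size_polyX size_poly1.
Qed.

(** The value at (g, g) is a positive combination of the weighted integrals of
    the squares of the two edge restrictions of g. *)
Lemma wedge_ip_eq0 sigma a b gam g :
  -1 < a -> -1 < b -> -1 < gam -> 0 < sigma ->
  wedge_ip sigma a b gam g g = 0 -> wedge_ideal g.
Proof.
move=> a1 b1 g1 s0; rewrite wedge_ipE /wedge_fun !subst2M -!expr2 => /eqP.
have ca := jacobi_const_gt0 a1 g1; have cb := jacobi_const_gt0 b1 g1.
rewrite paddr_eq0 ?mulr_ge0 ?jacobi_int_sqr_ge0 ?ltW//.
rewrite !mulf_eq0 !(gt_eqF ca, gt_eqF cb, gt_eqF s0)/=.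
move=> /andP[/eqP/(jacobi_int_sqr_eq0 a1 g1) gX /eqP/(jacobi_int_sqr_eq0 b1 g1) gY].
exact: wedge_idealP.
Qed.

End InnerProductFunctionals.

(** * Decomposition by parity *)

Section ParityDecomposition.
Context {R : realType}.
Implicit Types (a b gam c : R) (f g h p q : bipoly R).

Lemma msize_polXY i j : msize (polX ^+ i * polY ^+ j : bipoly R) = (i + j).+1.
Proof. by rewrite /polX /polY !mpolyXn -mpolyXD msizeX mdegD !mdegMn !mdeg1 !mul1n. Qed.

Lemma sqliftD (d1 d2 : bool) f g :
  sqlift d1 d2 (f + g) = sqlift d1 d2 f + sqlift d1 d2 g.
Proof. by rewrite /sqlift sqvarsD mulrDr. Qed.

Lemma sqliftZ (d1 d2 : bool) c f : sqlift d1 d2 (c *: f) = c *: sqlift d1 d2 f.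
Proof. by rewrite /sqlift sqvarsZ scalerAr. Qed.

Lemma sqlift0 (d1 d2 : bool) : sqlift d1 d2 (0 : bipoly R) = 0.
Proof. by rewrite /sqlift /sqvars comp_mpoly0 mulr0. Qed.

Lemma sqlift_polXY (d1 d2 : bool) i j :
  sqlift d1 d2 (polX ^+ i * polY ^+ j : bipoly R) =
  polX ^+ (d1 + i.*2) * polY ^+ (d2 + j.*2).
Proof.
have sexp p n : sqvars (p ^+ n : bipoly R) = sqvars p ^+ n.
  by elim: n => [|n IH]; rewrite ?expr0 ?sqvars1// !exprS sqvarsM IH.
rewrite /sqlift sqvarsM !sexp sqvarsX sqvarsY -!exprM !mul2n !exprD.
by rewrite mulrACA.
Qed.

(** The bound on q says 2 deg q + d1 + d2 < k, also when k is too small to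
    allow any nonzero q. *)
Lemma msize_sqlift_le (d1 d2 : bool) k q :
  (msize q <= (k.+1 - d1 - d2)./2)%N -> (msize (sqlift d1 d2 q) <= k)%N.
Proof.
move=> qk; apply: (@bipoly_span_ind R (fun q => msize (sqlift d1 d2 q) <= k)%N _ _ qk).
- by rewrite sqlift0 msize0.
- by move=> c p pk; rewrite sqliftZ (leq_trans (msizeZ_le _ _)).
- move=> p p' pk pk'; rewrite sqliftD (leq_trans (msizeD_le _ _))//.
  by rewrite geq_max pk.
- by move=> i j ij; rewrite sqlift_polXY msize_polXY; lia.
Qed.

Definition sqlift_sum (g : bool -> bool -> bipoly R) : bipoly R :=
  (sqlift false false (g false false) + sqlift true true (g true true)) +
  (sqlift true false (g true false) + sqlift false true (g false true)).

Lemma sqlift_sumD (u v : bool -> bool -> bipoly R) :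
  sqlift_sum (fun d1 d2 => u d1 d2 + v d1 d2) = sqlift_sum u + sqlift_sum v.
Proof.
have shuffle (V : nmodType) (x1 y1 x2 y2 x3 y3 x4 y4 : V) :
    (x1 + y1 + (x2 + y2)) + (x3 + y3 + (x4 + y4)) =
    (x1 + x2 + (x3 + x4)) + (y1 + y2 + (y3 + y4)).
  by rewrite (addrACA x1) (addrACA x3) addrACA.
by rewrite /sqlift_sum !sqliftD shuffle.
Qed.

Lemma sqlift_sumZ c (u : bool -> bool -> bipoly R) :
  sqlift_sum (fun d1 d2 => c *: u d1 d2) = c *: sqlift_sum u.
Proof. by rewrite /sqlift_sum !sqliftZ !scalerDr. Qed.

Lemma sqlift_sumB (u v : bool -> bool -> bipoly R) :
  sqlift_sum (fun d1 d2 => u d1 d2 - v d1 d2) = sqlift_sum u - sqlift_sum v.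
Proof.
rewrite -[- sqlift_sum v]scaleN1r -sqlift_sumZ -sqlift_sumD.
by congr sqlift_sum; apply/funext => d1; apply/funext => d2; rewrite scaleN1r.
Qed.

(** The monomial x^i y^j is the piece of parity (odd i, odd j) attached to
    x^(i / 2) y^(j / 2). *)
Lemma parity_decomposition k f : (msize f <= k)%N ->
  exists2 g, f = sqlift_sum g &
    forall d1 d2 : bool, (msize (g d1 d2) <= (k.+1 - d1 - d2)./2)%N.
Proof.
move=> fk; apply: (@bipoly_span_ind R (fun f => exists2 g, f = sqlift_sum g &
    forall d1 d2 : bool, (msize (g d1 d2) <= (k.+1 - d1 - d2)./2)%N) _ _ fk).
- exists (fun _ _ => 0); first by rewrite /sqlift_sum !sqlift0 !addr0.
  by move=> d1 d2; rewrite msize0.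
- move=> c p [g -> gk]; exists (fun d1 d2 => c *: g d1 d2).
    by rewrite sqlift_sumZ.
  by move=> d1 d2; rewrite (leq_trans (msizeZ_le _ _)).
- move=> p q [g -> gk] [h -> hk]; exists (fun d1 d2 => g d1 d2 + h d1 d2).
    by rewrite sqlift_sumD.
  move=> d1 d2; rewrite (leq_trans (msizeD_le _ _))//.
  by rewrite geq_max gk hk.
- move=> i j ij.
  exists (fun d1 d2 => if (d1 == odd i) && (d2 == odd j)
                       then polX ^+ i./2 * polY ^+ j./2 else 0).
    have e : polX ^+ i * polY ^+ j =
        sqlift (odd i) (odd j) (polX ^+ i./2 * polY ^+ j./2) :> bipoly R.
      by rewrite sqlift_polXY !odd_double_half.
    rewrite {1}e /sqlift_sum; move: (odd i) (odd j) => d1 d2.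
    by case: d1; case: d2; rewrite /= !sqlift0 ?addr0 ?add0r.
  move=> d1 d2; case: ifP => [/andP[/eqP -> /eqP ->]|]; last by rewrite msize0.
  rewrite msize_polXY; have := odd_double_half i; have := odd_double_half j.
  by lia.
Qed.

Lemma square_ipC a b gam f g : square_ip a b gam f g = square_ip a b gam g f.
Proof. by rewrite !square_ipE mulrC. Qed.

Lemma square_ipDr a b gam f g h : -1 < a -> -1 < b -> -1 < gam ->
  square_ip a b gam f (g + h) = square_ip a b gam f g + square_ip a b gam f h.
Proof.
move=> a1 b1 g1; rewrite !square_ipE mulrDr -[f * g]scale1r.
by rewrite square_fun_linear// mul1r scale1r.
Qed.

Lemma square_ip_sqlift_sum a b gam (d1 d2 : bool) f
    (g : bool -> bool -> bipoly R) :
  -1 < a -> -1 < b -> -1 < gam ->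
  square_ip a b gam (sqlift d1 d2 f) (sqlift_sum g) =
  sqlift_factor a gam d1 *
  wedge_ip (wedge_sigma a b gam d1 d2) (Defs.shift a d1) (Defs.shift b d2) gam
    f (g d1 d2).
Proof.
move=> a1 b1 g1; rewrite /sqlift_sum !square_ipDr// -square_ip_sqlift//.
have neq e1 e2 h : (d1, d2) != (e1, e2) ->
    square_ip a b gam (sqlift d1 d2 f) (sqlift e1 e2 h) = 0.
  by move=> de; exact: square_ip_sqlift_neq.
case: d1 neq; case: d2 => neq.
- by rewrite (neq false false _ isT) (neq true false _ isT)
    (neq false true _ isT) add0r !addr0.
- by rewrite (neq false false _ isT) (neq true true _ isT)
    (neq false true _ isT) !add0r addr0.
- by rewrite (neq false false _ isT) (neq true true _ isT)
    (neq true false _ isT) !add0r.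
- by rewrite (neq true true _ isT) (neq true false _ isT)
    (neq false true _ isT) !addr0.
Qed.

End ParityDecomposition.

(** * Bases modulo an ideal *)

Section Bases.
Context {R : realType}.
Implicit Types (f g h p q : bipoly R) (s : seq (bipoly R)) (J V : set (bipoly R)).

(** Coefficients indexed by naturals can be shifted and concatenated without
    casts between ordinal types. *)
Definition lincomb (c : nat -> R) s : bipoly R := \sum_(i < size s) c i *: s`_i.

Definition join_coef (m : nat) (c1 c2 : nat -> R) (i : nat) : R :=
  if (i < m)%N then c1 i else c2 (i - m)%N.

Lemma lincomb_cat c s1 s2 :
  lincomb c (s1 ++ s2) = lincomb c s1 + lincomb (fun i => c (size s1 + i)%N) s2.
Proof.
rewrite /lincomb size_cat big_split_ord/=; congr (_ + _); apply: eq_bigr => i _.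
  by rewrite nth_cat ltn_ord.
by rewrite nth_cat ltnNge leq_addr/= addKn.
Qed.

Lemma eq_lincomb c1 c2 s : (forall i, (i < size s)%N -> c1 i = c2 i) ->
  lincomb c1 s = lincomb c2 s.
Proof. by move=> e; apply: eq_bigr => i _; rewrite e. Qed.

Lemma lincomb_join c1 c2 s1 s2 :
  lincomb (join_coef (size s1) c1 c2) (s1 ++ s2) = lincomb c1 s1 + lincomb c2 s2.
Proof.
rewrite lincomb_cat; congr (_ + _); apply: eq_lincomb => i.
  by rewrite /join_coef => ->.
by move=> _; rewrite /join_coef ltnNge leq_addr/= addKn.
Qed.

Lemma lincomb_ord s (c : 'I_(size s) -> R) :
  exists c', \sum_(i < size s) c i *: s`_i = lincomb c' s /\
    forall i : 'I_(size s), c' i = c i.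
Proof.
exists (fun i => if insub i is Some j then c j else 0).
have e (i : 'I_(size s)) : (if insub (val i) is Some j then c j else 0) = c i.
  by rewrite valK.
by split => //; apply: eq_bigr => i _; rewrite e.
Qed.

Lemma basis_modP J V s : basis_mod J V s <->
  [/\ {in s, forall f, V f},
      forall c, J (lincomb c s) -> forall i, (i < size s)%N -> c i = 0 &
      forall f, V f -> exists c, J (f - lincomb c s)].
Proof.
split=> [[Vs fr sp]|[Vs fr sp]]; split => //.
- by move=> c Jc i si; exact: (fr (fun i => c i) Jc (Ordinal si)).
- by move=> f /sp[c]; have [c' [-> _]] := lincomb_ord c; exists c'.
- move=> c; have [c' [-> c'E]] := lincomb_ord c.
  by move=> Jc i; rewrite -c'E; exact: fr.
- by move=> f /sp[c Jc]; exists (fun i => c i).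
Qed.

(** The order of the list matters only for indexing the coefficients; this
    form suffices to interleave the degree 2 basis. *)
Lemma basis_mod_catC J V s1 s2 : basis_mod J V (s1 ++ s2) -> basis_mod J V (s2 ++ s1).
Proof.
move=> /basis_modP[Vs fr sp]; apply/basis_modP; split.
- by move=> f; rewrite mem_cat orbC -mem_cat; exact: Vs.
- move=> c; rewrite lincomb_cat addrC -lincomb_join => /fr z i.
  rewrite size_cat => ils.
  have [i2|i2] := ltnP i (size s2).
    have := z (size s1 + i)%N; rewrite size_cat ltn_add2l => /(_ i2).
    by rewrite /join_coef ltnNge leq_addr/= addKn.
  have := z (i - size s2)%N; rewrite size_cat /join_coef.
  have i1 : (i - size s2 < size s1)%N by lia.
  by rewrite (ltn_addr _ i1) i1 subnKC// => ->.
- move=> f /sp[c]; rewrite lincomb_cat [X in _ - X]addrC -lincomb_join => Jc.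
  by eexists; exact: Jc.
Qed.

Lemma principal_idealD (z f g : bipoly R) :
  principal_ideal z f -> principal_ideal z g -> principal_ideal z (f + g).
Proof. by move=> [h ->] [k ->]; exists (h + k); rewrite mulrDl. Qed.

Lemma principal_idealM (z f g : bipoly R) :
  principal_ideal z f -> principal_ideal z (g * f).
Proof. by move=> [h ->]; exists (g * h); rewrite mulrA. Qed.

Lemma principal_ideal0 (z : bipoly R) : principal_ideal z 0.
Proof. by exists 0; rewrite mul0r. Qed.

(** The substitution x -> x^2, y -> y^2 sends the generator of the wedge ideal
    to the generator of the ideal of the square. *)
Lemma square_ideal_sqlift (d1 d2 : bool) f :
  wedge_ideal f -> square_ideal (sqlift d1 d2 f).
Proof.
move=> [h ->]; rewrite /sqlift !sqvarsM.
have s1 z : sqvars (1 - z : bipoly R) = 1 - sqvars z.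
  by rewrite -scaleN1r sqvarsD sqvarsZ sqvars1 scaleN1r.
by rewrite !s1 sqvarsX sqvarsY mulrA; eexists.
Qed.

Lemma sqliftB (d1 d2 : bool) f g :
  sqlift d1 d2 (f - g) = sqlift d1 d2 f - sqlift d1 d2 g.
Proof. by rewrite -scaleN1r sqliftD sqliftZ scaleN1r. Qed.

Lemma square_ideal_sqlift_sum (g : bool -> bool -> bipoly R) :
  (forall d1 d2 : bool, wedge_ideal (g d1 d2)) -> square_ideal (sqlift_sum g).
Proof.
by move=> Wg; do 2?[apply: principal_idealD]; exact: square_ideal_sqlift.
Qed.

Lemma lincomb_sqlift (d1 d2 : bool) c s :
  lincomb c (map (sqlift d1 d2) s) = sqlift d1 d2 (lincomb c s).
Proof.
rewrite /lincomb size_map.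
elim/big_rec2: _ => [|i x y _ ->]; first by rewrite sqlift0.
by rewrite sqliftD sqliftZ (nth_map 0).
Qed.

Definition sqlift_blocks (s : bool -> bool -> seq (bipoly R)) : seq (bipoly R) :=
  (map (sqlift false false) (s false false) ++
   map (sqlift true true) (s true true)) ++
  (map (sqlift true false) (s true false) ++
   map (sqlift false true) (s false true)).

Lemma lincomb_blocks (s : bool -> bool -> seq (bipoly R))
    (c : bool -> bool -> nat -> R) : exists c',
  lincomb c' (sqlift_blocks s) =
  sqlift_sum (fun d1 d2 => lincomb (c d1 d2) (s d1 d2)).
Proof.
eexists; rewrite /sqlift_blocks /sqlift_sum -!lincomb_sqlift.
by rewrite -!lincomb_join.
Qed.

(** Conversely, cut c at the boundaries of the four blocks. *)
Lemma lincomb_blocks_inv (s : bool -> bool -> seq (bipoly R)) (c : nat -> R) :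
  exists c' : bool -> bool -> nat -> R,
    lincomb c (sqlift_blocks s) =
      sqlift_sum (fun d1 d2 => lincomb (c' d1 d2) (s d1 d2)) /\
    ((forall (d1 d2 : bool) i, (i < size (s d1 d2))%N -> c' d1 d2 i = 0) ->
     forall i, (i < size (sqlift_blocks s))%N -> c i = 0).
Proof.
pose m00 := size (s false false); pose m11 := size (s true true).
pose m10 := size (s true false).
exists (fun d1 d2 i => if d1 then if d2 then c (m00 + i) else c (m00 + m11 + i)
                       else if d2 then c (m00 + m11 + (m10 + i)) else c i)%N.
split.
  rewrite /sqlift_blocks /sqlift_sum !lincomb_cat !lincomb_sqlift.
  by rewrite !size_cat !size_map.
move=> z i; rewrite /sqlift_blocks !size_cat !size_map => ilt.
have [i0|i0] := ltnP i m00; first exact: (z false false).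
have [i1|i1] := ltnP i (m00 + m11).
  have := z true true (i - m00)%N; rewrite subnKC//; apply.
  by rewrite -/m11; lia.
have [i2|i2] := ltnP i (m00 + m11 + m10).
  have := z true false (i - (m00 + m11))%N; rewrite subnKC//; apply.
  by rewrite -/m10; lia.
have := z false true (i - (m00 + m11 + m10))%N; rewrite addnA subnKC//; apply.
by move: ilt; rewrite -/m00 -/m11 -/m10; lia.
Qed.

End Bases.

(** * The parity components of BV_n *)

Section GradedSpaces.
Context {R : realType}.
Variables (a b gam : R).
Implicit Types (f g h p q : bipoly R) (s : seq (bipoly R)).

Local Notation ipw d1 d2 := (wedge_ip (wedge_sigma a b gam d1 d2)
  (Defs.shift a d1) (Defs.shift b d2) gam).

(** The conditions on g for [sqlift d1 d2 g] to represent an element of BV_n.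
    The bounds are those of [msize], one more than the degree, and truncated
    subtraction makes them 0 when d1 + d2 exceeds n. *)
Definition graded_wedge (n : nat) (d1 d2 : bool) : set (bipoly R) :=
  [set f | exists g, [/\ wedge_ideal (f - g),
     (msize g <= (n.+2 - d1 - d2)./2)%N &
     forall q, (msize q <= (n.+1 - d1 - d2)./2)%N -> ipw d1 d2 g q = 0]].

Lemma basis_mod_graded_wedge n m (d1 d2 : bool) s :
  n = (m.*2 + d1 + d2)%N ->
  basis_mod wedge_ideal (wedge_space (wedge_sigma a b gam d1 d2)
    (Defs.shift a d1) (Defs.shift b d2) gam m) s ->
  basis_mod wedge_ideal (graded_wedge n d1 d2) s.
Proof.
move=> nE; rewrite /graded_wedge.
have -> : (n.+2 - d1 - d2)./2 = m.+1 by rewrite nE; lia.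
by have -> : (n.+1 - d1 - d2)./2 = m by rewrite nE; lia.
Qed.

Hypotheses (a1 : -1 < a) (b1 : -1 < b) (g1 : -1 < gam).

Let factor_neq0 (d1 : bool) : sqlift_factor a gam d1 != 0.
Proof. by rewrite gt_eqF// sqlift_factor_gt0. Qed.

(** Only the component of q with the same parity meets a piece, and its degree
    is small enough for the orthogonality on the wedge. *)
Lemma BV_sqlift n (d1 d2 : bool) f :
  graded_wedge n d1 d2 f -> BV a b gam n (sqlift d1 d2 f).
Proof.
move=> [g [Wfg gn og]]; exists (sqlift d1 d2 g); split.
- by rewrite -sqliftB; exact: square_ideal_sqlift.
- exact: msize_sqlift_le.
- move=> q /parity_decomposition[u -> un].
  by rewrite square_ip_sqlift_sum// og ?mulr0.
Qed.

(** Testing a representative against the single pieces [sqlift d1 d2 q]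
    isolates its component of parity (d1, d2). *)
Lemma BV_graded_parts n f : BV a b gam n f ->
  exists2 u, square_ideal (f - sqlift_sum u) &
    forall d1 d2 : bool, graded_wedge n d1 d2 (u d1 d2).
Proof.
move=> [g [If /parity_decomposition[u gE un] og]]; exists u; first by rewrite -gE.
move=> d1 d2; exists (u d1 d2); split => //.
  by rewrite subrr; exact: principal_ideal0.
move=> q qn; have := og _ (msize_sqlift_le qn).
rewrite square_ipC gE square_ip_sqlift_sum// => /eqP.
rewrite mulf_eq0 (negbTE (factor_neq0 d1))/= => /eqP.
by rewrite !wedge_ipE mulrC.
Qed.

(** The ideal is in the kernel of the inner product.  Pairing the sum with its
    own component gives the wedge norm of that component. *)
Lemma sqlift_sum_in_ideal (u : bool -> bool -> bipoly R) :
  square_ideal (sqlift_sum u) -> forall d1 d2 : bool, wedge_ideal (u d1 d2).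
Proof.
move=> Iu d1 d2.
have : square_ip a b gam (sqlift d1 d2 (u d1 d2)) (sqlift_sum u) = 0.
  by rewrite square_ipE square_fun_ideal//; exact: principal_idealM.
rewrite square_ip_sqlift_sum// => /eqP.
rewrite mulf_eq0 (negbTE (factor_neq0 d1))/= => /eqP.
by apply: wedge_ip_eq0; rewrite ?shift_gtN1// wedge_sigma_gt0.
Qed.

Lemma basis_mod_blocks n (s : bool -> bool -> seq (bipoly R)) :
  (forall d1 d2 : bool, basis_mod wedge_ideal (graded_wedge n d1 d2) (s d1 d2)) ->
  basis_mod square_ideal (BV a b gam n) (sqlift_blocks s).
Proof.
move=> bs; apply/basis_modP; split.
- move=> f; rewrite !mem_cat.
  have BVs (d1 d2 : bool) : f \in map (sqlift d1 d2) (s d1 d2) -> BV a b gam n f.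
    move=> /mapP[g gs ->]; apply: BV_sqlift.
    by have [Vs _ _] := bs d1 d2; exact: Vs.
  by case/orP => /orP[] /BVs.
- move=> c; have [c' [-> c0]] := lincomb_blocks_inv s c.
  move=> /sqlift_sum_in_ideal Ic; apply: c0 => d1 d2 i.
  by have /basis_modP[_ fr _] := bs d1 d2; apply: fr; exact: Ic.
- move=> f /BV_graded_parts[u If Vu].
  have /choice [C CP] : forall d : bool * bool, exists c,
      wedge_ideal (u d.1 d.2 - lincomb c (s d.1 d.2)).
    by move=> [d1 d2]; have /basis_modP[_ _ sp] := bs d1 d2; exact: sp.
  have [c cE] := lincomb_blocks s (fun d1 d2 => C (d1, d2)).
  exists c; rewrite cE.
  rewrite -[X in X - _](subrK (sqlift_sum u)) -addrA -sqlift_sumB.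
  apply: principal_idealD => //; apply: square_ideal_sqlift_sum => d1 d2.
  exact: (CP (d1, d2)).
Qed.

(** The representative may be tested against itself. *)
Lemma graded_wedge_eq n (d1 d2 : bool) f :
  (n.+2 - d1 - d2)./2 = (n.+1 - d1 - d2)./2 ->
  graded_wedge n d1 d2 f -> wedge_ideal f.
Proof.
move=> e [g [Wfg gn og]]; rewrite -(subrK g f); apply: principal_idealD => //.
apply: (@wedge_ip_eq0 _ (wedge_sigma a b gam d1 d2) (Defs.shift a d1)
  (Defs.shift b d2) gam); rewrite ?shift_gtN1 ?wedge_sigma_gt0//.
by apply: og; rewrite -e.
Qed.

Lemma basis_mod_graded_nil n (d1 d2 : bool) :
  (n.+2 - d1 - d2)./2 = (n.+1 - d1 - d2)./2 ->
  basis_mod wedge_ideal (graded_wedge n d1 d2) [::].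
Proof.
move=> e; apply/basis_modP; split => // f /(graded_wedge_eq e) Wf.
by exists (fun=> 0); rewrite /lincomb big_ord0 subr0.
Qed.

(** When n = d1 + d2 the degree bound is 0 and there is no orthogonality
    condition. *)
Lemma basis_mod_graded_cst (d1 d2 : bool) :
  basis_mod wedge_ideal (graded_wedge (d1 + d2) d1 d2) [:: 1].
Proof.
have e2 : ((d1 + d2).+2 - d1 - d2)./2 = 1%N by move: (d1) (d2) => [] [].
have e1 : ((d1 + d2).+1 - d1 - d2)./2 = 0%N by move: (d1) (d2) => [] [].
have l1 c : lincomb c [:: 1] = c 0%N *: 1 by rewrite /lincomb big_ord1.
apply/basis_modP; split.
- move=> f; rewrite inE => /eqP ->; exists 1; split.
  + by rewrite subrr; exact: principal_ideal0.
  + by rewrite e2 msize1.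
  + move=> q; rewrite e1 leqn0 msize_poly_eq0 => /eqP ->.
    rewrite wedge_ipE mulr0 wedge_fun_ideal ?shift_gtN1//.
    exact: principal_ideal0.
- move=> c; rewrite l1 => Wc [|//] _.
  have := @subst2_wedge_ideal R 'X 1 _ _ Wc.
  rewrite eqxx orbT subst2Z subst2_1 => /(_ isT)/eqP.
  by rewrite scaler_eq0 oner_eq0 orbF => /eqP.
- move=> f [g [Wfg]]; rewrite e2 => /msize1_polyC gE _.
  exists (fun=> mcoeff (mnm0) g); rewrite l1.
  by rewrite alg_mpolyC -gE.
Qed.

End GradedSpaces.

(** * Gluing the wedge bases *)

Section Assembly.
Context {R : realType}.
Variables (a b gam : R).

Definition harmonic_basis n (d1 d2 : bool) (s : seq (bipoly R)) : Prop :=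
  basis_mod wedge_ideal (graded_wedge a b gam n d1 d2) s /\
  {in s, forall p, dx (dy p) = 0}.

Lemma harmonic_basis_wedge n m (d1 d2 : bool) s :
  n = (m.*2 + d1 + d2)%N -> wedge_basis a b gam d1 d2 m s ->
  harmonic_basis n d1 d2 s.
Proof.
move=> nE [bs ds]; split; first exact: basis_mod_graded_wedge nE bs.
by move=> p /ds[].
Qed.

Hypotheses (a1 : -1 < a) (b1 : -1 < b) (g1 : -1 < gam).

Lemma harmonic_blocks n (s : bool -> bool -> seq (bipoly R)) :
  (forall d1 d2 : bool, harmonic_basis n d1 d2 (s d1 d2)) ->
  basis_mod square_ideal (BV a b gam n) (sqlift_blocks s) /\
  {in sqlift_blocks s, forall u, dx (dx (dy (dy u))) = 0}.
Proof.
move=> hs; split; first by apply: basis_mod_blocks => // d1 d2; case: (hs d1 d2).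
move=> u; rewrite !mem_cat.
have D (d1 d2 : bool) : u \in map (sqlift d1 d2) (s d1 d2) ->
    dx (dx (dy (dy u))) = 0.
  move=> /mapP[p ps ->]; apply: dxxyy_sqlift.
  by have [_ dp] := hs d1 d2; exact: dp.
by case/orP => /orP[] /D.
Qed.

(** This covers the two classes with the wrong parity, and the class (1, 1)
    for n = 0. *)
Lemma harmonic_basis_nil n (d1 d2 : bool) :
  (n.+2 - d1 - d2)./2 = (n.+1 - d1 - d2)./2 -> harmonic_basis n d1 d2 [::].
Proof. by move=> e; split=> //; exact: basis_mod_graded_nil. Qed.

Lemma harmonic_basis_cst (d1 d2 : bool) :
  harmonic_basis (d1 + d2) d1 d2 [:: 1].
Proof.
split; first exact: basis_mod_graded_cst.
move=> p; rewrite inE => /eqP ->.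
by rewrite /dx /dy -mpolyC1 mderivC mderiv0.
Qed.

End Assembly.

Theorem theorem3p2 (R : realType) (a b gam : R)
    (p1 p2 : bool -> bool -> nat -> bipoly R)
    (Y : nat -> seq (bipoly R)) :
  -1 < a -> -1 < b -> -1 < gam ->
  (forall (d1 d2 : bool) (m : nat), (1 <= m)%N ->
     wedge_basis a b gam d1 d2 m [:: p1 d1 d2 m; p2 d1 d2 m]) ->
  Y 0%N = [:: 1] ->
  Y 1%N = [:: polX; polY] ->
  Y 2%N = [:: sqvars (p1 false false 1%N); polX * polY;
              sqvars (p2 false false 1%N)] ->
  (forall m : nat, (2 <= m)%N ->
     Y (2 * m)%N = [:: sqvars (p1 false false m);
                       sqvars (p2 false false m);
                       polX * polY * sqvars (p1 true true m.-1);
                       polX * polY * sqvars (p2 true true m.-1)]) ->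
  (forall m : nat, (1 <= m)%N ->
     Y (2 * m + 1)%N = [:: polX * sqvars (p1 true false m);
                           polX * sqvars (p2 true false m);
                           polY * sqvars (p1 false true m);
                           polY * sqvars (p2 false true m)]) ->
  forall n : nat,
    basis_mod square_ideal (BV a b gam n) (Y n) /\
    {in Y n, forall u, dx (dx (dy (dy u))) = 0}.
Proof.
move=> a1 b1 g1 W Y0 Y1 Y2 Yeven Yodd n.
have L00 (p : bipoly R) : sqlift false false p = sqvars p.
  by rewrite /sqlift !expr0 !mul1r.
have L11 (p : bipoly R) : sqlift true true p = polX * polY * sqvars p.
  by rewrite /sqlift !expr1.
have L10 (p : bipoly R) : sqlift true false p = polX * sqvars p.
  by rewrite /sqlift expr1 expr0 mulr1.
have L01 (p : bipoly R) : sqlift false true p = polY * sqvars p.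
  by rewrite /sqlift expr1 expr0 mul1r.
have nil k d1 d2 := @harmonic_basis_nil R a b gam a1 b1 g1 k d1 d2.
have cst d1 d2 := @harmonic_basis_cst R a b gam a1 b1 g1 d1 d2.
have wdg k m (d1 d2 : bool) : (1 <= m)%N -> k = (m.*2 + d1 + d2)%N ->
    harmonic_basis a b gam k d1 d2 [:: p1 d1 d2 m; p2 d1 d2 m].
  by move=> m1 kE; apply: (harmonic_basis_wedge kE); exact: W.
have [->|n0] := eqVneq n 0%N.
  pose s (d1 d2 : bool) : seq (bipoly R) := if d1 || d2 then [::] else [:: 1].
  have -> : Y 0%N = sqlift_blocks s by rewrite Y0 /sqlift_blocks/= L00 sqvars1.
  by apply: harmonic_blocks => // -[] []; [exact: nil..|exact: (cst false false)].
have [->|n1] := eqVneq n 1%N.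
  pose s (d1 d2 : bool) : seq (bipoly R) := if d1 (+) d2 then [:: 1] else [::].
  have -> : Y 1%N = sqlift_blocks s.
    by rewrite Y1 /sqlift_blocks/= L10 L01 sqvars1 !mulr1.
  by apply: harmonic_blocks => // -[] [];
    [exact: nil|exact: (cst true false)|exact: (cst false true)|exact: nil].
have [->|n2] := eqVneq n 2%N.
  (* The lifted basis is listed as q, p, xy and rotated into p, xy, q. *)
  pose p := p1 false false 1%N; pose q := p2 false false 1%N.
  pose s (d1 d2 : bool) : seq (bipoly R) :=
    if d1 (+) d2 then [::] else if d1 then [:: 1] else [:: q; p].
  have sE : sqlift_blocks s = [:: sqvars q] ++ [:: sqvars p; polX * polY].
    by rewrite /sqlift_blocks/= !L00 L11 sqvars1 mulr1.
  have [bs ds] : basis_mod square_ideal (BV a b gam 2) (sqlift_blocks s) /\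
      {in sqlift_blocks s, forall u, dx (dx (dy (dy u))) = 0}.
    apply: harmonic_blocks => // -[] [] /=.
    - exact: (cst true true).
    - exact: nil.
    - exact: nil.
    - have [bpq dpq] := wdg 2%N 1%N false false isT erefl.
      split; first exact: (@basis_mod_catC _ _ _ [:: p] [:: q]).
      by move=> u uqp; apply: dpq; move: uqp; rewrite !inE orbC.
  have -> : Y 2%N = [:: sqvars p; polX * polY] ++ [:: sqvars q] by rewrite Y2.
  split; first by apply: basis_mod_catC; rewrite -sE.
  by move=> u; rewrite mem_cat orbC -mem_cat -sE; exact: ds.
pose m := n./2; have nE := odd_double_half n.
have [nodd|neven] := boolP (odd n).
  have m1 : (1 <= m)%N by rewrite /m; lia.
  have nm : n = (2 * m + 1)%N by rewrite /m; lia.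
  pose s (d1 d2 : bool) : seq (bipoly R) :=
    if d1 (+) d2 then [:: p1 d1 d2 m; p2 d1 d2 m] else [::].
  have -> : Y n = sqlift_blocks s.
    by rewrite nm (Yodd m m1) /sqlift_blocks/= !L10 !L01.
  apply: harmonic_blocks => // -[] [] /=.
  - by apply: nil; rewrite nm; lia.
  - by apply: wdg => //; rewrite nm; lia.
  - by apply: wdg => //; rewrite nm; lia.
  - by apply: nil; rewrite nm; lia.
have m2 : (2 <= m)%N by rewrite /m; lia.
have nm : n = (2 * m)%N by rewrite /m; lia.
pose s (d1 d2 : bool) : seq (bipoly R) :=
  if d1 (+) d2 then [::]
  else if d1 then [:: p1 d1 d2 m.-1; p2 d1 d2 m.-1]
  else [:: p1 d1 d2 m; p2 d1 d2 m].
have -> : Y n = sqlift_blocks s.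
  by rewrite nm (Yeven m m2) /sqlift_blocks/= !L00 !L11.
apply: harmonic_blocks => // -[] [] /=.
- by apply: wdg; [lia|rewrite nm; lia].
- by apply: nil; rewrite nm; lia.
- by apply: nil; rewrite nm; lia.
- by apply: wdg; [lia|rewrite nm; lia].
Qed.
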